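(* Let $X$ be a compact Riemann surface of genus $g\ge 1$ and let $x_0\in X$. Then every algebraic function $f\colon X\setminus\{x_0\}\to\mathbb{C}$ has a critical point, i.e. there is a point $x\in X\setminus\{x_0\}$ with $\mathrm{d}f_x=0$.
   Context: Riemann surfaces are connected (usual convention). An algebraic function on $X\setminus\{x_0\}$ is a holomorphic function $f\colon X\setminus\{x_0\}\to\mathbb{C}$ which extends to a meromorphic function on $X$ (equivalently, $f$ has at most a pole at $x_0$). *)

(* Defs.v *)
From HB Require Import structures.
From mathcomp Require Import all_boot all_order all_algebra.
From mathcomp Require Import complex.
From mathcomp Require Import all_classical all_reals all_analysis.

Set Implicit Arguments.
Unset Strict Implicit.
Unset Printing Implicit Defensive.

Import Order.TTheory GRing.Theory Num.Theory.
Import numFieldNormedType.Exports.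

Local Open Scope classical_set_scope.
Local Open Scope ring_scope.

(* The ascription to numClosedFieldType is what gives R[i] its norm topology:
   MathComp-Analysis attaches topologies to abstract number fields, and
   derivable f z 1 on C R is then complex differentiability, the increment h
   in the difference quotient ranging over complex numbers. *)
Definition C (R : realType) : numClosedFieldType := complex R.

Definition holomorphic_at (R : realType) (f : C R -> C R) (z : C R) : Prop :=
  \forall w \near z, derivable f w 1.

(* f has at most a pole at z; neither f z nor f at a pole matters. *)
Definition meromorphic_at (R : realType) (f : C R -> C R) (z : C R) : Prop :=
  exists (n : nat) (g : C R -> C R), holomorphic_at g z /\
    \forall w \near z^', (w - z) ^+ n * f w = g w.

(* A homeomorphism from an open subset of X onto an open subset of C. Both
   directions are total functions; chart_map is meaningful only on chart_dom,
   and chart_inv only on chart_map @` chart_dom. *)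
Record chart (R : realType) (X : topologicalType) := Chart {
  chart_dom : set X;
  chart_map :> X -> C R;
  chart_inv : C R -> X;
  chart_open_dom : open chart_dom;
  chart_open_im : open (chart_map @` chart_dom);
  chart_mapK : forall x, chart_dom x -> chart_inv (chart_map x) = x;
  chart_map_cont : {within chart_dom, continuous chart_map};
  chart_inv_cont : {within chart_map @` chart_dom, continuous chart_inv}
}.

(* The atlas need not be maximal. *)
Record riemannSurface (R : realType) := RiemannSurface {
  rs_space :> topologicalType;
  rs_atlas : set (chart R rs_space);
  rs_hausdorff : hausdorff_space rs_space;
  rs_connected : connected [set: rs_space];
  rs_cover : forall x, exists2 c, rs_atlas c & chart_dom c x;
  rs_compat : forall c c', rs_atlas c -> rs_atlas c' ->
    forall x, chart_dom c x -> chart_dom c' x ->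
      holomorphic_at (c' \o chart_inv c) (c x)
}.

Definition chart_at (R : realType) (X : riemannSurface R) (x : X)
    (c : chart R X) : Prop :=
  rs_atlas c /\ chart_dom c x.

(* For open U; the values of f off U are irrelevant, so that functions defined
   on U only are represented by arbitrary total extensions. *)
Definition holomorphic_on (R : realType) (X : riemannSurface R) (U : set X)
    (f : X -> C R) : Prop :=
  forall x c, U x -> chart_at x c -> holomorphic_at (f \o chart_inv c) (c x).

Definition meromorphic (R : realType) (X : riemannSurface R)
    (f : X -> C R) : Prop :=
  forall x c, chart_at x c -> meromorphic_at (f \o chart_inv c) (c x).

Definition algebraic_function (R : realType) (X : riemannSurface R) (x0 : X)
    (f : X -> C R) : Prop :=
  holomorphic_on (~` [set x0]) f /\
  exists F : X -> C R, meromorphic F /\ forall x, x <> x0 -> F x = f x.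

(* A differential form of type (1,0) is given by its coefficients: omega c x is
   the a such that omega = a dz at x, where z is the coordinate of the chart c.
   Only the values with chart_at x c are meaningful. *)
Definition oneform (R : realType) (X : riemannSurface R) : Type :=
  chart R X -> X -> C R.

Definition form_eq (R : realType) (X : riemannSurface R)
    (omega eta : oneform X) : Prop :=
  forall x c, chart_at x c -> omega c x = eta c x.

Definition form_zero_at (R : realType) (X : riemannSurface R)
    (omega : oneform X) (x : X) : Prop :=
  forall c, chart_at x c -> omega c x = 0.

(* The first clause is the transformation rule a dz = a' (dz'/dz) dz. *)
Definition holomorphic_form (R : realType) (X : riemannSurface R)
    (omega : oneform X) : Prop :=
  (forall x c c', chart_at x c -> chart_at x c' ->
     omega c x = omega c' x * derive1 (c' \o chart_inv c) (c x)) /\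
  (forall x c, chart_at x c ->
     holomorphic_at (omega c \o chart_inv c) (c x)).

Definition differential (R : realType) (X : riemannSurface R)
    (f : X -> C R) : oneform X :=
  fun c x => derive1 (f \o chart_inv c) (c x).

Definition lincomb_form (R : realType) (X : riemannSurface R) (n : nat)
    (a : 'I_n -> C R) (w : 'I_n -> oneform X) : oneform X :=
  fun c x => \sum_(i < n) a i * w i c x.

(* The genus of a compact Riemann surface is the complex dimension of its space
   of holomorphic 1-forms: w is a basis of that space. *)
Definition has_genus (R : realType) (X : riemannSurface R) (g : nat) : Prop :=
  exists w : 'I_g -> oneform X,
    [/\ forall i, holomorphic_form (w i),
        forall a : 'I_g -> C R,
          form_eq (lincomb_form a w) (fun _ _ => 0) -> forall i, a i = 0
      & forall eta : oneform X, holomorphic_form eta ->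
          exists a : 'I_g -> C R, form_eq eta (lincomb_form a w)].

Definition critical_point (R : realType) (X : riemannSurface R)
    (f : X -> C R) (x : X) : Prop :=
  form_zero_at (differential f) x.

(* Main.v *)
Require Import Defs.
From mathcomp Require Import all_boot all_order all_algebra.
From mathcomp Require Import complex.
From mathcomp Require Import all_classical all_reals all_analysis.
From mathcomp Require Import ring lra.

(* Let w be a nonzero holomorphic 1-form, which exists because the genus is
   positive, and suppose that f has no critical point off x0. Then h = w / df
   is holomorphic off x0. If f extends holomorphically to x0, it is constant by
   compactness, and every point is critical. Otherwise f has a pole at x0, so
   that 1 / df, hence h, extends holomorphically to x0 with value 0. But
   a holomorphic function on a compact surface is constant, so h = 0 and w = 0.

   The local theory (order of vanishing, holomorphy of the derivative, maximum
   principle) rests on Cauchy's formula for a rectangle, which needs no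
   trigonometry: the winding integral of 1 / (z - w) along the boundary is only
   shown to have positive imaginary part, and f is recovered as the quotient of
   the Cauchy integral of f by that of 1. *)

(** Complex differentiability comes without continuity of the derivative, so Cauchy's theorem is
    proved by bisection; the Cauchy formula then applies it to a difference quotient that is only
    known to be continuous at one point. In place of the constant [2 pi i], the integral [W] of
    [1 / (z - w)] stays in the formulas as a nonvanishing holomorphic factor: differentiating
    [f * W] expresses [f'] by Cauchy integrals, and repeated division under the integral sign plays
    the part of the Taylor series.

    At a pole of order [m + 1], [f = g / (z - z0)^(m + 1)] gives [f' = q / (z - z0)^(m + 2)], where
    [q] takes the value [-(m + 1) g(z0)] at [z0], nonzero in characteristic 0. The quotient of a
    form by [df] is a function because a change of chart multiplies both by the same factor. Its
    vanishing kills the form off [x0] only; the value at [x0] follows by continuity. *)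

Set Implicit Arguments.
Unset Strict Implicit.
Unset Printing Implicit Defensive.

Import Order.TTheory GRing.Theory Num.Theory.
Import numFieldNormedType.Exports.

Local Open Scope classical_set_scope.
Local Open Scope ring_scope.
Local Open Scope complex_scope.

Local Notation Re := complex.Re.
Local Notation Im := complex.Im.

(* Instance search does not see through the coercion chain from [C R] to
   [topologicalType], so the filter structure of [nbhs w] is redeclared. *)
#[global] Instance nbhs_C_filter (R : realType) (w : C R) :
  Filter (nbhs w).
Proof. exact: nbhs_filter. Qed.

(** * The modulus as a real number *)

Section RealModulus.
Variable R : realType.
Implicit Types z w : C R.

Lemma ReD z w : Re (z + w) = Re z + Re w.
Proof. by case: z; case: w. Qed.

Lemma ImD z w : Im (z + w) = Im z + Im w.
Proof. by case: z; case: w. Qed.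

Lemma ReB z w : Re (z - w) = Re z - Re w.
Proof. by case: z; case: w. Qed.

Lemma ImB z w : Im (z - w) = Im z - Im w.
Proof. by case: z; case: w. Qed.

Definition cplx (s t : R) : C R := s +i* t.

(** The norm of [C R] takes its values in [C R], which is only partially ordered; its real part is a
    quantity to which the order of [R] and [lra] apply. *)
Definition modulus z : R := Re (`|z| : R[i]).

Lemma normE z : `|z| = (modulus z)%:C.
Proof. by rewrite /modulus RRe_real // normr_real. Qed.

Lemma modulus_ge0 z : 0 <= modulus z.
Proof. by rewrite -ler0c -normE normr_ge0. Qed.

Lemma modulus0 : modulus 0 = 0.
Proof. by rewrite /modulus normr0. Qed.

Lemma modulus_eq0 z : (modulus z == 0) = (z == 0).
Proof. by rewrite -[RHS]normr_eq0 normE -(inj_eq (@complexI R)). Qed.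

Lemma modulus_gt0 z : (0 < modulus z) = (z != 0).
Proof. by rewrite lt0r modulus_ge0 andbT modulus_eq0. Qed.

Lemma modulusD z w : modulus (z + w) <= modulus z + modulus w.
Proof. by rewrite -lecR rmorphD -!normE ler_normD. Qed.

Lemma modulusN z : modulus (- z) = modulus z.
Proof. by rewrite /modulus normrN. Qed.

Lemma modulusB z w : modulus (z - w) <= modulus z + modulus w.
Proof. by rewrite -(modulusN w) modulusD. Qed.

Lemma modulus_distC z w : modulus (z - w) = modulus (w - z).
Proof. by rewrite -modulusN opprB. Qed.

Lemma modulusM z w : modulus (z * w) = modulus z * modulus w.
Proof. by apply: complexI; rewrite rmorphM -!normE normrM. Qed.

Lemma modulusX z n : modulus (z ^+ n) = modulus z ^+ n.
Proof. by apply: complexI; rewrite rmorphXn -!normE normrX. Qed.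

Lemma modulusV z : modulus z^-1 = (modulus z)^-1.
Proof. by apply: complexI; rewrite fmorphV -!normE normfV. Qed.

Lemma modulus_real (x : R) : modulus x%:C = `|x|.
Proof. by rewrite /modulus normc_def /= expr0n addr0 sqrtr_sqr. Qed.

Lemma Re_le_modulus z : `|Re z| <= modulus z.
Proof. by rewrite -lecR -normE normc_ge_Re. Qed.

Lemma modulusi : modulus 'i%C = 1.
Proof. by rewrite /modulus normc_def /= expr0n add0r expr1n sqrtr1. Qed.

Lemma Im_le_modulus z : `|Im z| <= modulus z.
Proof.
by have := Re_le_modulus (z * 'i%C); rewrite ReiNIm normrN modulusM modulusi mulr1.
Qed.

Lemma modulus_le z : modulus z <= `|Re z| + `|Im z|.
Proof.
rewrite [z in modulus z]complexE (le_trans (modulusD _ _)) //.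
by rewrite modulusM modulusi mul1r !modulus_real.
Qed.

Lemma cvg_modulusP (T : Type) (F : set_system T) {FF : Filter F}
    (f : T -> C R) (l : C R) :
  f @ F --> l <-> forall e : R, 0 < e -> \forall t \near F, modulus (l - f t) < e.
Proof.
split=> [/cvgrPdist_lt fl e e0|fl].
  have := fl e%:C; rewrite ltcR => /(_ e0).
  by apply: filterS => t; rewrite normE ltcR.
apply/cvgrPdist_lt => e e0.
have er : e = (Re e)%:C by rewrite RRe_real // gtr0_real.
move: e0; rewrite er ltcR => /fl.
by apply: filterS => t; rewrite normE ltcR.
Qed.

Lemma nbhs_modulusP (z : C R) (A : set (C R)) :
  nbhs z A <-> exists2 e : R, 0 < e & forall w, modulus (w - z) < e -> A w.
Proof.
split=> [/nbhs_normP [e /= e0 eA]|[e e0 eA]].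
  have er : e = (Re e)%:C by rewrite RRe_real // gtr0_real.
  move: e0; rewrite er ltcR => e0; exists (Re e) => // w wz.
  by apply: eA; rewrite /= er distrC normE ltcR.
apply/nbhs_normP; exists e%:C => /=; first by rewrite ltcR.
by move=> w /=; rewrite distrC normE ltcR => /eA.
Qed.

Lemma cvg_modulus (T : Type) (F : set_system T) {FF : Filter F}
    (f : T -> C R) (l : C R) :
  f @ F --> l -> (fun t => modulus (f t)) @ F --> modulus l.
Proof.
move=> /cvg_modulusP fl; apply/cvgrPdist_lt => e /fl; apply: filterS => t.
apply: le_lt_trans; rewrite ler_norml; apply/andP; split.
  rewrite lerNl opprB lerBlDr modulus_distC.
  by have := modulusD (f t - l) l; rewrite subrK.
by have := modulusD (l - f t) (f t); rewrite subrK lerBlDr.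
Qed.

Lemma cvg_Re (T : Type) (F : set_system T) {FF : Filter F}
    (f : T -> C R) (l : C R) :
  f @ F --> l -> (fun t => Re (f t)) @ F --> Re l.
Proof.
move=> /cvg_modulusP fl; apply/cvgrPdist_lt => e /fl; apply: filterS => t.
by apply: le_lt_trans; have := Re_le_modulus (l - f t); rewrite raddfB.
Qed.

Lemma cvg_Im (T : Type) (F : set_system T) {FF : Filter F}
    (f : T -> C R) (l : C R) :
  f @ F --> l -> (fun t => Im (f t)) @ F --> Im l.
Proof.
move=> /cvg_modulusP fl; apply/cvgrPdist_lt => e /fl; apply: filterS => t.
by apply: le_lt_trans; have := Im_le_modulus (l - f t); rewrite raddfB.
Qed.

Lemma cvg_cplx (T : Type) (F : set_system T) {FF : Filter F}
    (f g : T -> R) (a b : R) :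
  f @ F --> a -> g @ F --> b -> (fun t => cplx (f t) (g t)) @ F --> cplx a b.
Proof.
move=> /cvgrPdist_lt fa /cvgrPdist_lt gb; apply/cvg_modulusP => e e0.
have e20 : 0 < e / 2 by rewrite divr_gt0.
apply: filterS2 (fa _ e20) (gb _ e20) => t ft gt.
apply: le_lt_trans (modulus_le _) _ => /=.
by rewrite (splitr e) ltrD.
Qed.

End RealModulus.

(** * Integrals of complex-valued functions of a real variable *)

Section ComplexIntegral.
Variable R : realType.
Implicit Types (a b t : R) (u v : R -> C R).

Local Notation mu := (@lebesgue_measure R).

Definition cint a b u : C R :=
  (\int[mu]_(t in `[a, b]) Re (u t)) +i* (\int[mu]_(t in `[a, b]) Im (u t)).

(** Limits are two-sided even at [a] and [b]. The integrands are restrictions of functions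
    continuous at each point of the path as a point of the plane, so this strong form is available,
    and it passes to subsegments without subspace topologies. *)
Definition continuous_on a b u :=
  forall t, a <= t <= b -> u x @[x --> t] --> u t.

Lemma continuous_on_sub a b a' b' u : a <= a' -> b' <= b ->
  continuous_on a b u -> continuous_on a' b' u.
Proof.
move=> aa bb cu t /andP[at' tb]; apply: cu.
by rewrite (le_trans aa at') (le_trans tb bb).
Qed.

Lemma continuous_on_Re a b u : continuous_on a b u ->
  mu.-integrable `[a, b] (EFin \o (fun t => Re (u t))).
Proof.
move=> cu; apply: continuous_compact_integrable; first exact: segment_compact.
apply: continuous_in_subspaceT => t; rewrite inE /= in_itv /= => tab.
exact: cvg_Re (cu t tab).
Qed.

Lemma continuous_on_Im a b u : continuous_on a b u ->
  mu.-integrable `[a, b] (EFin \o (fun t => Im (u t))).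
Proof.
move=> cu; apply: continuous_compact_integrable; first exact: segment_compact.
apply: continuous_in_subspaceT => t; rewrite inE /= in_itv /= => tab.
exact: cvg_Im (cu t tab).
Qed.

Lemma eq_cint a b u v : (forall t, a <= t <= b -> u t = v t) ->
  cint a b u = cint a b v.
Proof.
move=> uv; rewrite /cint.
congr Complex; apply: eq_Rintegral => t; rewrite inE /= in_itv /= => tab;
  by rewrite uv.
Qed.

Lemma cintD a b u v : continuous_on a b u -> continuous_on a b v ->
  cint a b (fun t => u t + v t) = cint a b u + cint a b v.
Proof.
move=> cu cv; apply/eqP; rewrite eq_complex ReD ImD /=.
apply/andP; split; apply/eqP.
  under eq_Rintegral do rewrite ReD.
  by rewrite RintegralD //; exact: continuous_on_Re.
under eq_Rintegral do rewrite ImD.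
by rewrite RintegralD //; exact: continuous_on_Im.
Qed.

Lemma cintZ a b (k : C R) u : continuous_on a b u ->
  cint a b (fun t => k * u t) = k * cint a b u.
Proof.
move=> cu; case: k => x y; rewrite /cint.
have iR := continuous_on_Re cu; have iI := continuous_on_Im cu.
have ReM (z : R[i]) : Re ((x +i* y) * z) = x * Re z - y * Im z by case: z.
have ImM (z : R[i]) : Im ((x +i* y) * z) = x * Im z + y * Re z by case: z.
have iZ (r : R) (g : R -> R) : mu.-integrable `[a, b] (EFin \o g) ->
    mu.-integrable `[a, b] (EFin \o (fun t => r * g t)).
  by move=> ig; exact: (@integrableZl _ _ R mu _ _ r (EFin \o g)).
apply/eqP; rewrite eq_complex ReM ImM /=; apply/andP; split; apply/eqP.
  under eq_Rintegral do rewrite ReM.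
  by rewrite RintegralB ?RintegralZl //; exact: iZ.
under eq_Rintegral do rewrite ImM.
by rewrite RintegralD ?RintegralZl //; exact: iZ.
Qed.

Lemma continuous_onD a b u v : continuous_on a b u -> continuous_on a b v ->
  continuous_on a b (fun t => u t + v t).
Proof. by move=> cu cv t tab; apply: cvgD; [exact: cu|exact: cv]. Qed.

Lemma continuous_onM a b u v : continuous_on a b u -> continuous_on a b v ->
  continuous_on a b (fun t => u t * v t).
Proof. by move=> cu cv t tab; apply: cvgM; [exact: cu|exact: cv]. Qed.

Lemma continuous_on_cst a b (k : C R) : continuous_on a b (fun _ => k).
Proof. by move=> t _; exact: cvg_cst. Qed.

Lemma continuous_onZ a b (k : C R) u : continuous_on a b u ->
  continuous_on a b (fun t => k * u t).
Proof. by move=> cu; exact: continuous_onM (@continuous_on_cst a b k) cu. Qed.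

Lemma continuous_onN a b u : continuous_on a b u ->
  continuous_on a b (fun t => - u t).
Proof. by move=> cu t tab; apply: cvgN; exact: cu. Qed.

Lemma continuous_onB a b u v : continuous_on a b u -> continuous_on a b v ->
  continuous_on a b (fun t => u t - v t).
Proof. by move=> cu cv; exact: continuous_onD cu (continuous_onN cv). Qed.

Lemma cintN a b u : continuous_on a b u ->
  cint a b (fun t => - u t) = - cint a b u.
Proof.
move=> cu; rewrite -mulN1r -cintZ //; apply: eq_cint => t _; by rewrite mulN1r.
Qed.

Lemma cintB a b u v : continuous_on a b u -> continuous_on a b v ->
  cint a b (fun t => u t - v t) = cint a b u - cint a b v.
Proof. by move=> cu cv; rewrite (cintD cu (continuous_onN cv)) (cintN cv). Qed.

Lemma Rintegral_segment_cst a b (r : R) : a <= b ->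
  \int[mu]_(t in `[a, b]) r = r * (b - a).
Proof.
move=> ab; rewrite Rintegral_cst //=.
rewrite lebesgue_measure_itv /=; case: ifPn => // /negP; rewrite lte_fin => nab.
suff -> : b = a by rewrite subrr.
by apply/eqP; rewrite eq_le ab andbT leNgt; apply/negP.
Qed.

Lemma cint_cst a b (k : C R) : a <= b ->
  cint a b (fun _ => k) = (b - a)%:C * k.
Proof.
move=> ab; case: k => x y; rewrite /cint /= !Rintegral_segment_cst //.
by simpc; rewrite ![_ * (b - a)]mulrC.
Qed.

(** The factor 2 comes from bounding the real and the imaginary part separately; it is harmless,
    since the estimate only serves to make quantities small. *)
Lemma modulus_cint a b (M : R) u : a <= b -> continuous_on a b u ->
  (forall t, a <= t <= b -> modulus (u t) <= M) ->
  modulus (cint a b u) <= 2 * (M * (b - a)).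
Proof.
move=> ab cu uM.
have bnd (g : R -> R) : mu.-integrable `[a, b] (EFin \o g) ->
    (forall t, `|g t| <= modulus (u t)) ->
    `|\int[mu]_(t in `[a, b]) g t| <= M * (b - a).
  move=> ig gu; apply: le_trans (le_normr_Rintegral _ ig) _ => //.
  rewrite -Rintegral_segment_cst //; apply: le_Rintegral => //.
  - by have := integrable_norm ig.
  - apply: continuous_compact_integrable; first exact: segment_compact.
    by apply: continuous_subspaceT => t; exact: cvg_cst.
  - by move=> t; rewrite /= in_itv /= => /uM; apply: le_trans.
apply: le_trans (modulus_le _) _; rewrite mulr_natl mulr2n lerD //=.
  by apply: bnd => [|t]; [exact: continuous_on_Re|exact: Re_le_modulus].
by apply: bnd => [|t]; [exact: continuous_on_Im|exact: Im_le_modulus].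
Qed.

Lemma cint_split a m b u : a <= m -> m <= b -> continuous_on a b u ->
  cint a b u = cint a m u + cint m b u.
Proof.
move=> am mb cu.
have spl (g : R -> R) : mu.-integrable `[a, b] (EFin \o g) ->
    \int[mu]_(t in `[a, b]) g t =
    \int[mu]_(t in `[a, m]) g t + \int[mu]_(t in `[m, b]) g t.
  move=> ig; rewrite -[LHS](subrK (\int[mu]_(t in `[a, m]) g t)) addrC.
  congr (_ + _); rewrite Rintegral_itvB ?bnd_simp // Rintegral_itv_obnd_cbnd //.
  apply: integrableS ig => //; apply: subset_itvr; rewrite bnd_simp //.
rewrite /cint spl ?[X in _ +i* X]spl //; first exact: continuous_on_Im.
exact: continuous_on_Re.
Qed.

(* Uniformity in t comes from the compactness of [a, b], in the form of the
   tube lemma [near_covering]. *)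
Lemma cvg_cint_param (T : topologicalType) (z0 : T) (K : T -> R -> C R) a b :
  a <= b ->
  (\forall z \near z0, continuous_on a b (K z)) ->
  (forall t, a <= t <= b ->
     (fun p : T * R => K p.1 p.2) @ (nbhs z0, nbhs t) --> K z0 t) ->
  (fun z => cint a b (K z)) @ z0 --> cint a b (K z0).
Proof.
move=> ab cK jK; apply/cvg_modulusP => e e0.
have L0 : 0 < 4 * (b - a + 1) by rewrite mulr_gt0 // ltr_wpDl // subr_ge0.
(* The final bound is [2 * (e' * (b - a))]; adding 1 keeps the denominator positive when [a = b] and
   leaves room for a strict inequality. *)
pose e' := e / (4 * (b - a + 1)).
have e'0 : 0 < e' by rewrite divr_gt0.
have cK0 : continuous_on a b (K z0) by exact: nbhs_singleton cK.
have /compact_near_coveringP /(_ T (nbhs z0)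
    (fun z t => modulus (K z0 t - K z t) < e')) : compact `[a, b].
  exact: segment_compact.
move=> /(_ _) tube.
have {}tube : \forall z \near z0, forall t, a <= t <= b ->
    modulus (K z0 t - K z t) < e'.
  apply: (filterS _ (tube _)) => [z zU t tab|t].
    by apply: zU; rewrite /= in_itv.
  rewrite /= in_itv /= => tab.
  have e'20 : 0 < e' / 2 by rewrite divr_gt0.
  have /cvg_modulusP /(_ _ e'20) [[A B] [/= nA nB] AB] := jK t tab.
  exists (B, A) => //= -[t' z] [/= Bt' Az].
  have := AB (z, t') (conj Az Bt').
  have := AB (z0, t') (conj (nbhs_singleton nA) Bt').
  rewrite /= => h1 h2.
  (* Joint continuity compares values with [K z0 t] only, so it is used twice, the second time with
     parameter [z0]. *)
  have -> : K z0 t' - K z t' = (K z0 t - K z t') - (K z0 t - K z0 t') by ring.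
  by apply: le_lt_trans (modulusB _ _) _; rewrite (splitr e') ltrD.
apply: filterS2 tube cK => z zU cKz.
rewrite -cintB //; apply: le_lt_trans (@modulus_cint a b e' _ ab _ _) _.
- exact: continuous_onB.
- by move=> t /zU /ltW.
have -> : e = 4 * (e' * (b - a + 1)).
  by rewrite mulrCA /e' divfK // gt_eqF.
have : 0 <= e' * (b - a) by rewrite mulr_ge0 ?subr_ge0 // ltW.
nra.
Qed.

End ComplexIntegral.

(** * Complex derivatives and first-order approximation *)

Section ComplexDerivative.
Variable R : realType.
Implicit Types (F L : C R -> C R) (z w : C R).

Lemma derivable_cts F z : derivable F z 1 -> F @ z --> F z.
Proof. by move=> /derivable1_diffP /differentiable_continuous. Qed.

Lemma derivable_approx F z : derivable F z 1 -> forall e : R, 0 < e ->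
  \forall w \near z,
    modulus (F w - F z - derive1 F z * (w - z)) <= e * modulus (w - z).
Proof.
move=> dF e e0; rewrite derive1E.
move: dF => /cvg_modulusP /(_ _ e0); rewrite /dnbhs near_withinE.
move=> /nbhs_modulusP [d d0 dP]; apply/nbhs_modulusP; exists d => // w wz.
have [->|wDz] := eqVneq w z.
  by rewrite !subrr mulr0 subr0 modulus0 mulr0.
have hD : w - z != 0 by rewrite subr_eq0.
have := dP (w - z); rewrite subr0 => /(_ wz hD) /ltW.
rewrite -[X in _ -> X <= _]modulusN [e * _]mulrC -ler_pdivrMl ?modulus_gt0 //.
rewrite -modulusV -modulusM; congr (modulus _ <= e).
rewrite /derive !/(_ *: _) /= mulr1 subrK.
set D := lim _.
by field.
Qed.

(** Carathéodory's criterion: a factorisation with [L] continuous at [z] replaces the limit of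
    difference quotients. It suits integrals with a parameter, where [L] is itself an integral. *)
Lemma is_derive_quotient F L z :
  (\forall w \near z, F w - F z = (w - z) * L w) -> L @ z --> L z ->
  is_derive z 1 F (L z).
Proof.
move=> FL Lz.
have cL : (fun h : C R => h^-1 *: ((F \o shift z) (h *: 1) - F z)) @ 0^' --> L z.
  apply/cvg_modulusP => e e0; rewrite /dnbhs near_withinE.
  move/cvg_modulusP: Lz => /(_ _ e0) Lz.
  have [d d0 dP] : exists2 d : R, 0 < d & forall w, modulus (w - z) < d ->
      F w - F z = (w - z) * L w /\ modulus (L z - L w) < e.
    by apply/nbhs_modulusP; apply: filterI.
  apply/nbhs_modulusP; exists d => // h; rewrite subr0 => hd h0.
  have [] := dP (h + z); first by rewrite addrK.
  rewrite addrK /= /(_ *: _) /= mulr1 => ->.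
  by rewrite mulrA mulVf // mul1r.
apply: DeriveDef; first by apply/cvg_ex; exists (L z).
by apply: cvg_lim => //; exact: norm_hausdorff.
Qed.

End ComplexDerivative.

(** * Goursat's theorem on rectangles *)

Section Bisection.
Variable R : realType.

Lemma nested_point (a b : nat -> R) : (forall n, a n <= a n.+1) ->
  (forall n, b n.+1 <= b n) -> (forall n, a n <= b n) ->
  exists s, forall n, a n <= s <= b n.
Proof.
move=> ai bd ab.
have am n k : a n <= a (k + n)%N.
  by elim: k => // k IH; apply: le_trans IH (ai _).
have bm n k : b (k + n)%N <= b n.
  by elim: k => // k IH; apply: le_trans (bd _) IH.
have anbm n m : a n <= b m.
  by apply: le_trans (am n m) _; rewrite addnC; apply: le_trans (ab _) (bm m n).
exists (sup (range a)) => n; apply/andP; split.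
  apply: ub_le_sup; last by exists n.
  by exists (b 0%N) => _ [m _ <-].
apply: ge_sup; first by exists (a 0%N), 0%N.
by move=> _ [m _ <-].
Qed.

Lemma half_pow_small (L e : R) : 0 < e -> exists n, L / 2 ^+ n < e.
Proof.
move=> e0; exists (Num.bound (L / e)).
rewrite ltr_pdivrMr ?exprn_gt0 // mulrC -ltr_pdivrMr //.
have [L0|L0] := leP 0 (L / e).
  apply: lt_trans (archi_boundP L0) _.
  by rewrite -natrX ltr_nat ltn_expl.
by apply: lt_trans L0 _; rewrite exprn_gt0.
Qed.

(** If [P] fails on a rectangle, it fails on one of its quarters; the nested failing quarters shrink
    to a point [(s, t)], where the local hypothesis is contradicted. That hypothesis concerns only
    rectangles containing the point, which is where a derivative gives information. *)
Lemma rect_bisection (P : R -> R -> R -> R -> Prop) (a b c d : R) :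
  a <= b -> c <= d ->
  (forall a' b' c' d', a <= a' -> a' <= b' -> b' <= b ->
     c <= c' -> c' <= d' -> d' <= d ->
     let m := (a' + b') / 2 in let n := (c' + d') / 2 in
     P a' m c' n -> P a' m n d' -> P m b' c' n -> P m b' n d' ->
     P a' b' c' d') ->
  (forall s t, a <= s <= b -> c <= t <= d ->
     exists2 e : R, 0 < e & forall a' b' c' d',
       a <= a' -> a' <= s <= b' -> b' <= b ->
       c <= c' -> c' <= t <= d' -> d' <= d ->
       b' - a' < e -> d' - c' < e -> P a' b' c' d') ->
  P a b c d.
Proof.
move=> ab cd split small; apply: contrapT => nP.
pose inr (q : R * R * R * R) := let: (a', b', c', d') := q in
  [/\ a <= a' , a' <= b', b' <= b & [/\ c <= c', c' <= d' & d' <= d]].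
pose bad (q : R * R * R * R) := let: (a', b', c', d') := q in
  inr q /\ ~ P a' b' c' d'.
pose sub (q r : R * R * R * R) :=
  let: (a', b', c', d') := q in let: (a1, b1, c1, d1) := r in
  [/\ a' <= a1, b1 <= b', c' <= c1 & d1 <= d'] /\
  (b1 - a1 = (b' - a') / 2 /\ d1 - c1 = (d' - c') / 2).
(* Stated for all [q], with [q] itself as a dummy witness when it is not bad, so that [choice]
   returns a map that can be iterated. *)
have step q : exists r, bad q -> bad r /\ sub q r.
  have [|nb] := pselect (bad q); last by exists q.
  case: q => [[[a' b'] c'] d'] [[aa ab' bb [cc cd' dd]] nPq].
  set m := (a' + b') / 2; set n := (c' + d') / 2.
  have am : a' <= m by rewrite /m; lra.
  have mb : m <= b' by rewrite /m; lra.
  have cn : c' <= n by rewrite /n; lra.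
  have nd : n <= d' by rewrite /n; lra.
  have [P1|nP1] := pselect (P a' m c' n); last first.
    exists (a', m, c', n) => _; rewrite /bad /inr /sub; do !split=> //;
      rewrite /m /n; lra.
  have [P2|nP2] := pselect (P a' m n d'); last first.
    exists (a', m, n, d') => _; rewrite /bad /inr /sub; do !split=> //;
      rewrite /m /n; lra.
  have [P3|nP3] := pselect (P m b' c' n); last first.
    exists (m, b', c', n) => _; rewrite /bad /inr /sub; do !split=> //;
      rewrite /m /n; lra.
  have [P4|nP4] := pselect (P m b' n d'); last first.
    exists (m, b', n, d') => _; rewrite /bad /inr /sub; do !split=> //;
      rewrite /m /n; lra.
  by case: nPq; apply: split.
have [f fP] := choice step.
pose q n := iter n f (a, b, c, d).
have qbad n : bad (q n).
  by elim: n => [|n IH] /=; [split|have [] := fP _ IH].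
have qsub n : sub (q n) (q n.+1) by have [] := fP _ (qbad n).
pose qa n := (q n).1.1.1; pose qb n := (q n).1.1.2.
pose qc n := (q n).1.2; pose qd n := (q n).2.
have qE n : q n = (qa n, qb n, qc n, qd n).
  by rewrite /qa /qb /qc /qd; case: (q n) => [[[]]].
have qbad' n : bad (qa n, qb n, qc n, qd n) by rewrite -qE.
have qsub' n : sub (qa n, qb n, qc n, qd n) (qa n.+1, qb n.+1, qc n.+1, qd n.+1).
  by rewrite -!qE.
have [s sP] : exists s, forall n, qa n <= s <= qb n.
  by apply: nested_point => n; [have [[]] := qsub' n|have [[]] := qsub' n|
    have [[]] := qbad' n].
have [t tP] : exists t, forall n, qc n <= t <= qd n.
  by apply: nested_point => n; [have [[]] := qsub' n|have [[]] := qsub' n|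
    have [[? ? ? []]] := qbad' n].
have wid n : qb n - qa n = (b - a) / 2 ^+ n /\ qd n - qc n = (d - c) / 2 ^+ n.
  elim: n => [|n [IHa IHc]]; first by rewrite expr0 !divr1.
  have [_ [-> ->]] := qsub' n.
  by rewrite IHa IHc !exprS !invfM; split; ring.
have [e e0 eP] := small s t (sP 0%N) (tP 0%N).
(* The sum of the two initial widths dominates each, so one [n] serves both directions. *)
have [n nP'] := half_pow_small ((b - a) + (d - c)) e0.
have [[h1 h2 h3 [h4 h5 h6]]] := qbad' n; apply.
have p0 : 0 < (2 ^+ n : R)^-1 by rewrite invr_gt0 exprn_gt0.
have [wa wc] := wid n.
apply: eP => //; rewrite ?wa ?wc; nra.
Qed.

End Bisection.

Section Goursat.
Variable R : realType.
Implicit Types (F : C R -> C R) (a b c d s t : R) (z w : C R).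

(** The counterclockwise integral of [F dz], with opposite sides merged into one integrand: [dz] is
    [ds] on horizontal sides and [i dt] on vertical ones. *)
Definition rect_int F a b c d : C R :=
  cint a b (fun s => F (cplx s c) - F (cplx s d)) +
  'i%C * cint c d (fun t => F (cplx b t) - F (cplx a t)).

Lemma continuous_on_horizontal F a b t :
  (forall s, a <= s <= b -> F @ cplx s t --> F (cplx s t)) ->
  continuous_on a b (fun s => F (cplx s t)).
Proof.
move=> cF s sab; apply: (@cvg_comp _ _ _ (fun s => cplx s t) F _ (nbhs (cplx s t))).
  by apply: cvg_cplx => //; exact: cvg_cst.
exact: cF.
Qed.

Lemma continuous_on_vertical F s c d :
  (forall t, c <= t <= d -> F @ cplx s t --> F (cplx s t)) ->
  continuous_on c d (fun t => F (cplx s t)).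
Proof.
move=> cF t tcd; apply: (@cvg_comp _ _ _ (fun t => cplx s t) F _ (nbhs (cplx s t))).
  by apply: cvg_cplx => //; exact: cvg_cst.
exact: cF.
Qed.

Definition rect_continuous F a b c d :=
  forall s t, a <= s <= b -> c <= t <= d -> F @ cplx s t --> F (cplx s t).

Lemma rect_continuous_sub F a b c d a' b' c' d' :
  a <= a' -> b' <= b -> c <= c' -> d' <= d ->
  rect_continuous F a b c d -> rect_continuous F a' b' c' d'.
Proof.
move=> aa bb cc dd cF s t /andP[h1 h2] /andP[h3 h4]; apply: cF.
  by rewrite (le_trans aa) // (le_trans h2).
by rewrite (le_trans cc) // (le_trans h4).
Qed.

Lemma rect_continuous_h F a b c d t : rect_continuous F a b c d ->
  c <= t <= d -> continuous_on a b (fun s => F (cplx s t)).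
Proof. by move=> cF tcd; apply: continuous_on_horizontal => s sab; exact: cF. Qed.

Lemma rect_continuous_v F a b c d s : rect_continuous F a b c d ->
  a <= s <= b -> continuous_on c d (fun t => F (cplx s t)).
Proof. by move=> cF tcd; apply: continuous_on_vertical => t tab; exact: cF. Qed.

Lemma rect_int_splith F a m b c d : a <= m -> m <= b -> c <= d ->
  rect_continuous F a b c d ->
  rect_int F a b c d = rect_int F a m c d + rect_int F m b c d.
Proof.
move=> am mb cd cF; rewrite /rect_int.
have ab := le_trans am mb.
rewrite (cint_split am mb); last first.
  by apply: continuous_onB; apply: rect_continuous_h cF _; rewrite ?lexx ?cd.
rewrite -addrA -[RHS]addrA; congr (_ + _); rewrite [RHS]addrCA; congr (_ + _).
have cv x : a <= x <= b -> continuous_on c d (fun t => F (cplx x t)).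
  exact: rect_continuous_v cF.
have ca : continuous_on c d (fun t => F (cplx a t)) by apply: cv; rewrite lexx.
have cm : continuous_on c d (fun t => F (cplx m t)) by apply: cv; rewrite am.
have cb : continuous_on c d (fun t => F (cplx b t)) by apply: cv; rewrite lexx andbT.
by rewrite !cintB //; ring.
Qed.

Lemma rect_int_splitv F a b c n d : a <= b -> c <= n -> n <= d ->
  rect_continuous F a b c d ->
  rect_int F a b c d = rect_int F a b c n + rect_int F a b n d.
Proof.
move=> ab cn nd cF; rewrite /rect_int.
have cd := le_trans cn nd.
have ch x : c <= x <= d -> continuous_on a b (fun t => F (cplx t x)).
  exact: rect_continuous_h cF.
have cc : continuous_on a b (fun t => F (cplx t c)) by apply: ch; rewrite lexx.
have cm : continuous_on a b (fun t => F (cplx t n)) by apply: ch; rewrite cn.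
have cD : continuous_on a b (fun t => F (cplx t d)) by apply: ch; rewrite lexx andbT.
rewrite (@cint_split _ c n d) //; last first.
  by apply: continuous_onB; apply: rect_continuous_v cF _; rewrite ?lexx ?ab.
by rewrite (cintB cc cD) (cintB cc cm) (cintB cm cD); ring.
Qed.

(* Affine functions contribute nothing to the boundary integral. *)
Lemma rect_int_affine_approx F (z A : C R) (e : R) a b c d :
  a <= b -> c <= d -> 0 <= e -> rect_continuous F a b c d ->
  (forall s t, a <= s <= b -> c <= t <= d ->
     modulus (F (cplx s t) - F z - A * (cplx s t - z)) <= e) ->
  modulus (rect_int F a b c d) <= 4 * (e * ((b - a) + (d - c))).
Proof.
move=> ab cd e0 cF Fe; rewrite /rect_int.
pose E w := F w - F z - A * (w - z).
have cE : rect_continuous E a b c d.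
  move=> s t hs ht.
  exact: cvgB (cvgB (cF s t hs ht) (cvg_cst _))
    (cvgM (cvg_cst A) (cvgB cvg_id (cvg_cst z))).
have ha : a <= a <= b by rewrite lexx.
have hb : a <= b <= b by rewrite lexx andbT.
have hc : c <= c <= d by rewrite lexx.
have hd : c <= d <= d by rewrite lexx andbT.
have cEh := rect_continuous_h cE; have cEv := rect_continuous_v cE.
(* Opposite sides differ by a constant vector: the affine part contributes [-i A (b - a) (d - c)]
   here and the opposite amount on the vertical sides. *)
have -> : cint a b (fun s => F (cplx s c) - F (cplx s d)) =
    cint a b (fun s => E (cplx s c) - E (cplx s d)) +
    (b - a)%:C * (A * (0 -i* (d - c))).
  rewrite -cint_cst // -cintD; first last.
  - exact: continuous_on_cst.
  - by apply: continuous_onB; apply: cEh.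
  apply: eq_cint => s _.
  have -> : 0 -i* (d - c) = cplx s c - cplx s d :> C R.
    by rewrite /cplx; simpc; congr Complex; ring.
  rewrite /E; ring.
have -> : cint c d (fun t => F (cplx b t) - F (cplx a t)) =
    cint c d (fun t => E (cplx b t) - E (cplx a t)) +
    (d - c)%:C * (A * (b - a)%:C).
  rewrite -cint_cst // -cintD; first last.
  - exact: continuous_on_cst.
  - by apply: continuous_onB; apply: cEv.
  apply: eq_cint => t _.
  have -> : (b - a)%:C = cplx b t - cplx a t :> C R.
    by rewrite /cplx; simpc; congr Complex; ring.
  rewrite /E; ring.
set U := cint a b _; set V := cint c d _.
have -> : U + (b - a)%:C * (A * (0 -i* (d - c))) +
  'i * (V + (d - c)%:C * (A * (b - a)%:C)) = U + 'i * V.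
  have -> : 0 -i* (d - c) = - ('i * (d - c)%:C) :> C R.
    by simpc; congr Complex; ring.
  ring.
apply: le_trans (modulusD _ _) _; rewrite modulusM modulusi mul1r.
have -> : 4 * (e * (b - a + (d - c))) =
  2 * ((2 * e) * (b - a)) + 2 * ((2 * e) * (d - c)) by ring.
apply: lerD; apply: modulus_cint => //.
- by apply: continuous_onB; apply: cEh.
- move=> s hs; apply: le_trans (modulusB _ _) _.
  by rewrite mulr_natl mulr2n lerD // /E; apply: Fe.
- by apply: continuous_onB; apply: cEv.
- move=> s hs; apply: le_trans (modulusB _ _) _.
  by rewrite mulr_natl mulr2n lerD // /E; apply: Fe.
Qed.

(** With [L] the sum of the two side lengths, the bound [e * L ^+ 2] is exactly preserved by
    bisection, since [4 (L / 2)^2 = L^2]. On a small rectangle the affine approximation errs by at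
    most [e / 4 * L], and integration multiplies this by [4 L]. *)
Lemma goursat F a b c d : a <= b -> c <= d ->
  (forall s t, a <= s <= b -> c <= t <= d -> derivable F (cplx s t) 1) ->
  rect_int F a b c d = 0.
Proof.
move=> ab cd dF.
have cF : rect_continuous F a b c d.
  by move=> s t hs ht; apply: derivable_cts; exact: dF.
suff bound (e : R) : 0 < e ->
    modulus (rect_int F a b c d) <= e * ((b - a) + (d - c)) ^+ 2.
  apply/eqP; rewrite -modulus_eq0 eq_le modulus_ge0 andbT.
  apply/ler_addgt0Pr => e e0; rewrite add0r.
  set L := (b - a) + (d - c) in bound.
  have L0 : 0 <= L by rewrite addr_ge0 // subr_ge0.
  have e'0 : 0 < e / (L ^+ 2 + 1) by rewrite divr_gt0 // ltr_wpDl // sqr_ge0.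
  apply: le_trans (bound _ e'0) _.
  rewrite mulrAC ler_pdivrMr ?ltr_wpDl ?sqr_ge0 //.
  by rewrite mulrDr mulr1 lerDl ltW.
move=> e0.
apply: (@rect_bisection _ (fun a' b' c' d' =>
  modulus (rect_int F a' b' c' d') <= e * ((b' - a') + (d' - c')) ^+ 2) a b c d ab cd).
- move=> a' b' c' d' aa ab' bb cc cd' dd m n P1 P2 P3 P4.
  have [am mb] := midf_le ab'; have [cn nd] := midf_le cd'.
  have cF' : rect_continuous F a' b' c' d' by exact: rect_continuous_sub cF.
  have cFl : rect_continuous F a' m c' d' by exact: rect_continuous_sub cF'.
  have cFr : rect_continuous F m b' c' d' by exact: rect_continuous_sub cF'.
  rewrite (rect_int_splith am mb cd' cF').
  rewrite (rect_int_splitv am cn nd cFl) (rect_int_splitv mb cn nd cFr).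
  apply: le_trans (modulusD _ _) _.
  apply: le_trans (lerD (modulusD _ _) (modulusD _ _)) _.
  apply: le_trans (lerD (lerD P1 P2) (lerD P3 P4)) _.
  by rewrite le_eqVlt; apply/orP; left; apply/eqP; rewrite /m /n; field.
- move=> s t hs ht.
  have e40 : 0 < e / 4 by rewrite divr_gt0.
  have /nbhs_modulusP [r r0 rP] := derivable_approx (dF s t hs ht) e40.
  (* Sides below [r / 2] have sum below [r], and this sum bounds the distance to [(s, t)]. *)
  exists (r / 2); first by rewrite divr_gt0.
  move=> a' b' c' d' aa /andP[as' sb] bb cc /andP[ct td] dd wab wcd.
  have ab' : a' <= b' by exact: le_trans sb.
  have cd' : c' <= d' by exact: le_trans td.
  have L0 : 0 <= (b' - a') + (d' - c') by rewrite addr_ge0 // subr_ge0.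
  have -> : e * (b' - a' + (d' - c')) ^+ 2 =
      4 * ((e / 4 * (b' - a' + (d' - c'))) * (b' - a' + (d' - c'))) by field.
  apply: (@rect_int_affine_approx F (cplx s t) (derive1 F (cplx s t))) => //.
  + by rewrite mulr_ge0 // ltW.
  + exact: rect_continuous_sub cF.
  + move=> s' t' /andP[as1 sb1] /andP[ct1 td1].
    have small : modulus (cplx s' t' - cplx s t) <= (b' - a') + (d' - c').
      apply: le_trans (modulus_le _) _; rewrite /cplx; simpc => /=.
      by apply: lerD; rewrite ler_norml; lra.
    apply: le_trans (rP _ _) _; last by rewrite ler_wpM2l // ltW.
    by apply: le_lt_trans small _; lra.
Qed.

End Goursat.

(** * Cauchy's theorem with an exceptional point *)

Section CauchyFormula.
Variable R : realType.
Implicit Types (F G : C R -> C R) (a b c d s t : R) (z w : C R).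

Lemma cvg_cplx_comp (T : Type) (FT : set_system T) {FF : Filter FT} F
    (f g : T -> R) s t :
  F @ cplx s t --> F (cplx s t) -> f @ FT --> s -> g @ FT --> t ->
  (fun x => F (cplx (f x) (g x))) @ FT --> F (cplx s t).
Proof.
move=> cF fs gt.
exact: (cvg_comp _ _ (cvg_cplx fs gt) cF).
Qed.

(** In a thin strip around the line [Re z = u] the horizontal sides are short, and the two vertical
    integrals nearly cancel because the vertical integral depends continuously on the abscissa.
    Continuity of [F] suffices for both. *)
Lemma rect_int_thin F a b c d u : a < u < b -> c <= d ->
  rect_continuous F a b c d -> forall e : R, 0 < e ->
  exists s s', [/\ a < s, s < u, u < s', s' < b &
    modulus (rect_int F s s' c d) <= e].
Proof.
move=> /andP[au ub] cd cF e e0.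
have uab : a <= u <= b by rewrite !ltW.
have hc : c <= c <= d by rewrite lexx.
have hd : c <= d <= d by rewrite lexx andbT.
have near_ab : \forall s \near u, a < s < b.
  by apply: filterS2 (lt_nbhsr au) (lt_nbhsl ub) => s sa sb; rewrite sa sb.
have cV : (fun s => cint c d (fun t => F (cplx s t))) @ u -->
    cint c d (fun t => F (cplx u t)).
  apply: (@cvg_cint_param R R u (fun s t => F (cplx s t)) c d cd).
    apply: filterS near_ab => s /andP[sa sb].
    by apply: rect_continuous_v cF _; rewrite !ltW.
  move=> t tcd; apply: cvg_cplx_comp (cF u t uab tcd) _ _.
    exact: cvg_fst.
  exact: cvg_snd.
pose k s := F (cplx s c) - F (cplx s d).
have ck : k @ u --> k u.
  apply: cvgB; apply: cvg_cplx_comp (cF u _ uab _) _ (cvg_cst _) => //.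
pose M := modulus (k u) + 1.
have M0 : 0 < M by rewrite ltr_wpDl // modulus_ge0.
have e40 : 0 < e / 4 by rewrite divr_gt0.
have e80 : 0 < e / (8 * M) by rewrite divr_gt0 // mulr_gt0.
have /nbhs_ballP [r /= r0 rP] : \forall s \near u, [/\ a < s < b,
    modulus (k s) < M & modulus (cint c d (fun t => F (cplx u t)) -
      cint c d (fun t => F (cplx s t))) < e / 4].
  move/cvg_modulusP: cV => /(_ _ e40) cV.
  move/cvg_modulusP: ck => /(_ _ ltr01) ck.
  apply: filterS3 near_ab ck cV => s h1 h2 h3; split=> //.
  have -> : k s = k u - (k u - k s) by ring.
  by apply: le_lt_trans (modulusB _ _) _; rewrite ltrD2l.
(* The first bound keeps the strip inside the neighbourhood [rP]; the second makes the horizontal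
   part, at most [2 * (M * (2 * h))], no larger than [e / 2]. *)
pose h := Num.min (r / 2) (e / (8 * M)).
have h0 : 0 < h by rewrite lt_min e80 divr_gt0.
have hr : h < r by rewrite /h gt_min; apply/orP; left; lra.
have he : h <= e / (8 * M) by rewrite /h ge_min lexx orbT.
have inb s : u - h <= s <= u + h -> ball u r s.
  move=> /andP[h1 h2]; rewrite /ball /=; apply: le_lt_trans hr.
  by rewrite ler_norml; lra.
exists (u - h), (u + h).
have [/andP[s1 _] _ V1] := rP (u - h) ltac:(apply: inb; lra).
have [/andP[_ s2] _ V2] := rP (u + h) ltac:(apply: inb; lra).
split=> //; [lra|lra|].
rewrite /rect_int; apply: le_trans (modulusD _ _) _.
rewrite modulusM modulusi mul1r (splitr e); apply: lerD.
  apply: le_trans (@modulus_cint _ _ _ M _ _ _ _) _.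
  - lra.
  - apply: (@continuous_on_sub _ a b); [lra|lra|].
    by apply: continuous_onB; apply: rect_continuous_h cF _.
  - by move=> s hs; have [_ /ltW] := rP s (inb s hs).
  - have -> : u + h - (u - h) = 2 * h by ring.
    have -> : e / 2 = 2 * (M * (2 * (e / (8 * M)))) by field; rewrite gt_eqF.
    by rewrite ler_pM2l // ler_pM2l // ler_pM2l.
rewrite cintB; first last.
- by apply: rect_continuous_v cF _; lra.
- by apply: rect_continuous_v cF _; lra.
set V := cint c d (fun t => F (cplx u t)) in V1 V2.
set A := cint c d _ in V2 *; set B := cint c d _ in V1 *.
have -> : A - B = (V - B) - (V - A) by ring.
by apply: le_trans (modulusB _ _) _; lra.
Qed.

(** Two vertical cuts enclose [w] in a strip of arbitrarily small integral and leave two rectangles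
    to which [goursat] applies. *)
Lemma goursat_except F a b c d w : a < Re w < b -> c <= d ->
  rect_continuous F a b c d ->
  (forall s t, a <= s <= b -> c <= t <= d -> cplx s t <> w ->
     derivable F (cplx s t) 1) ->
  rect_int F a b c d = 0.
Proof.
move=> wab cd cF dF; apply/eqP; rewrite -modulus_eq0 eq_le modulus_ge0 andbT.
apply/ler_addgt0Pr => e e0; rewrite add0r.
have [s [s' [as_ su us sb small]]] := rect_int_thin wab cd cF e0.
have cF' : rect_continuous F s b c d.
  by apply: rect_continuous_sub cF => //; exact: ltW.
rewrite (@rect_int_splith _ F a s b) //; try lra.
rewrite (@rect_int_splith _ F s s' b) //; try lra.
rewrite (@goursat _ F a s) //; try lra; last first.
  move=> x y hx hy; apply: dF => //; first lra.
  by move=> wE; move: su; rewrite -wE /=; lra.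
rewrite (@goursat _ F s' b) //; try lra; last first.
  move=> x y hx hy; apply: dF => //; first lra.
  by move=> wE; move: us; rewrite -wE /=; lra.
by rewrite add0r addr0.
Qed.

End CauchyFormula.

(** * Boundary integrals depending on a parameter *)

Section BoundaryIntegral.
Variable R : realType.
Variables (a b c d : R).
Hypotheses (ab : a < b) (cd : c < d).
Implicit Types (F G : C R -> C R) (z w : C R).

Let ableq : a <= b := ltW ab.
Let cdleq : c <= d := ltW cd.

Definition rect_boundary z := (a <= Re z <= b /\ (Im z = c \/ Im z = d)) \/
  (c <= Im z <= d /\ (Re z = a \/ Re z = b)).

Definition rect_interior z := a < Re z < b /\ c < Im z < d.

(** Continuity is asked on the boundary only, because Cauchy kernels have their pole inside. *)
Definition boundary_continuous F :=
  forall z, rect_boundary z -> F @ z --> F z.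

Local Notation oint F := (rect_int F a b c d).

Lemma boundary_c s : a <= s <= b -> rect_boundary (cplx s c).
Proof. by move=> h; left; split => //; left. Qed.
Lemma boundary_d s : a <= s <= b -> rect_boundary (cplx s d).
Proof. by move=> h; left; split => //; right. Qed.
Lemma boundary_a t : c <= t <= d -> rect_boundary (cplx a t).
Proof. by move=> h; right; split => //; left. Qed.
Lemma boundary_b t : c <= t <= d -> rect_boundary (cplx b t).
Proof. by move=> h; right; split => //; right. Qed.

Lemma boundary_continuous_on F : boundary_continuous F ->
  [/\ continuous_on a b (fun s => F (cplx s c)),
      continuous_on a b (fun s => F (cplx s d)),
      continuous_on c d (fun t => F (cplx a t)) &
      continuous_on c d (fun t => F (cplx b t))].
Proof.
move=> cF; split.
- by apply: continuous_on_horizontal => s h; apply: cF; exact: boundary_c.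
- by apply: continuous_on_horizontal => s h; apply: cF; exact: boundary_d.
- by apply: continuous_on_vertical => s h; apply: cF; exact: boundary_a.
- by apply: continuous_on_vertical => s h; apply: cF; exact: boundary_b.
Qed.

Lemma eq_rect_int F G : (forall z, rect_boundary z -> F z = G z) ->
  oint F = oint G.
Proof.
move=> FG; rewrite /rect_int; congr (_ + _ * _); apply: eq_cint => t h.
  by rewrite !FG //; [exact: boundary_d|exact: boundary_c].
by rewrite !FG //; [exact: boundary_a|exact: boundary_b].
Qed.

Lemma rect_intZ (k : C R) F : boundary_continuous F ->
  oint (fun z => k * F z) = k * oint F.
Proof.
move=> /boundary_continuous_on [cc cD ca cb]; rewrite /rect_int.
rewrite (cintB (@continuous_onZ _ _ _ k _ cc) (@continuous_onZ _ _ _ k _ cD)).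
rewrite (cintB (@continuous_onZ _ _ _ k _ cb) (@continuous_onZ _ _ _ k _ ca)).
rewrite (cintB cc cD) (cintB cb ca) !cintZ //; ring.
Qed.

Lemma rect_intD F G : boundary_continuous F -> boundary_continuous G ->
  oint (fun z => F z + G z) = oint F + oint G.
Proof.
move=> /boundary_continuous_on [cc cD ca cb].
move=> /boundary_continuous_on [cc' cD' ca' cb']; rewrite /rect_int.
rewrite (cintB (continuous_onD cc cc') (continuous_onD cD cD')).
rewrite (cintB (continuous_onD cb cb') (continuous_onD ca ca')).
rewrite (cintB cc cD) (cintB cb ca) (cintB cc' cD') (cintB cb' ca').
rewrite (cintD cc cc') (cintD cD cD') (cintD cb cb') (cintD ca ca'); ring.
Qed.

Lemma modulus_rect_int F (M : R) : boundary_continuous F ->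
  (forall z, rect_boundary z -> modulus (F z) <= M) ->
  modulus (oint F) <= 4 * (M * ((b - a) + (d - c))).
Proof.
move=> /boundary_continuous_on [cc cD ca cb] FM; rewrite /rect_int.
apply: le_trans (modulusD _ _) _; rewrite modulusM modulusi mul1r.
have -> : 4 * (M * (b - a + (d - c))) =
  2 * ((2 * M) * (b - a)) + 2 * ((2 * M) * (d - c)) by ring.
apply: lerD; [apply: (modulus_cint ableq)|apply: (modulus_cint cdleq)].
- exact: continuous_onB cc cD.
- move=> s hs; apply: le_trans (modulusB _ _) _.
  by rewrite mulr_natl mulr2n lerD //; apply: FM;
    [exact: boundary_c|exact: boundary_d].
- exact: continuous_onB cb ca.
- move=> s hs; apply: le_trans (modulusB _ _) _.
  by rewrite mulr_natl mulr2n lerD //; apply: FM;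
    [exact: boundary_b|exact: boundary_a].
Qed.

Lemma cvg_rect_int_param (z0 : C R) (K : C R -> C R -> C R) :
  (\forall z \near z0, boundary_continuous (K z)) ->
  (forall w, rect_boundary w ->
     (fun p : C R * C R => K p.1 p.2) @ (nbhs z0, nbhs w) --> K z0 w) ->
  (fun z => oint (K z)) @ z0 --> oint (K z0).
Proof.
move=> cK jK; rewrite /rect_int.
(* All four sides are paths [(f, g)] with one coordinate the identity and the other constant. *)
have jh (f g : R -> R) (t : R) : rect_boundary (cplx (f t) (g t)) ->
    f @ t --> f t -> g @ t --> g t ->
    (fun p : C R * R => K p.1 (cplx (f p.2) (g p.2))) @ (nbhs z0, nbhs t) -->
    K z0 (cplx (f t) (g t)).
  move=> hb cf cg.
  have hc : (fun p : C R * R => (p.1, cplx (f p.2) (g p.2)))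
      @ (nbhs z0, nbhs t) --> (nbhs z0, nbhs (cplx (f t) (g t))).
    apply: cvg_pair; first exact: cvg_fst.
    exact: (cvg_cplx (cvg_comp _ _ cvg_snd cf) (cvg_comp _ _ cvg_snd cg)).
  exact: (cvg_comp _ _ hc (jK _ hb)).
have hH := @cvg_cint_param R _ z0
  (fun z s => K z (cplx s c) - K z (cplx s d)) a b ableq.
have hV := @cvg_cint_param R _ z0
  (fun z t => K z (cplx b t) - K z (cplx a t)) c d cdleq.
refine (cvgD (hH _ _) (cvgM (cvg_cst _) (hV _ _))).
- apply: filterS cK => z /boundary_continuous_on [cc cD _ _].
  exact: continuous_onB cc cD.
- move=> t ht; apply: cvgB.
    exact: (jh id (fun=> c) t (boundary_c ht) cvg_id (cvg_cst _)).
  exact: (jh id (fun=> d) t (boundary_d ht) cvg_id (cvg_cst _)).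
- apply: filterS cK => z /boundary_continuous_on [_ _ ca cb].
  exact: continuous_onB cb ca.
- move=> t ht; apply: cvgB.
    exact: (jh (fun=> b) id t (boundary_b ht) (cvg_cst _) cvg_id).
  exact: (jh (fun=> a) id t (boundary_a ht) (cvg_cst _) cvg_id).
Qed.

(** Differentiation under the integral sign: the kernels at hand factor exactly through [w - w0], so
    the integral of [L w] is the difference quotient, and only its continuity in [w] is at stake. *)
Lemma is_derive_rect_int (K L : C R -> C R -> C R) (w0 : C R) :
  (\forall w \near w0, boundary_continuous (K w)) ->
  (\forall w \near w0, boundary_continuous (L w)) ->
  (\forall w \near w0, forall z, rect_boundary z ->
     K w z - K w0 z = (w - w0) * L w z) ->
  (forall z, rect_boundary z ->
     (fun p : C R * C R => L p.1 p.2) @ (nbhs w0, nbhs z) --> L w0 z) ->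
  is_derive w0 1 (fun w => oint (K w)) (oint (L w0)).
Proof.
move=> cK cL KL jL.
apply: (@is_derive_quotient _ _ (fun w => oint (L w))); last first.
  exact: cvg_rect_int_param cL jL.
have cK0 := nbhs_singleton cK.
apply: filterS3 cK cL KL => w cKw cLw KLw.
rewrite -rect_intZ // -(eq_rect_int KLw).
have cN : boundary_continuous (fun z => - 1 * K w0 z).
  by move=> z hz; apply: cvgM (cvg_cst _) (cK0 z hz).
rewrite -[- oint _]mulN1r -rect_intZ // -rect_intD //.
by apply: eq_rect_int => z _; rewrite mulN1r.
Qed.

End BoundaryIntegral.

(** * Rules of differentiability and the filled-in difference quotient *)

Section Derivability.
Variable R : realType.
Implicit Types (f g : C R -> C R) (z : C R).

Lemma derivable_mul f g z : derivable f z 1 -> derivable g z 1 ->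
  derivable (fun w => f w * g w) z 1.
Proof. by move=> df dg; exact: (derivableM df dg). Qed.

Lemma derivable_sub f g z : derivable f z 1 -> derivable g z 1 ->
  derivable (fun w => f w - g w) z 1.
Proof. by move=> df dg; exact: (derivableB df dg). Qed.

Lemma derivable_inv f z : f z != 0 -> derivable f z 1 ->
  derivable (fun w => (f w)^-1) z 1.
Proof. by move=> f0 df; exact: (derivableV f0 df). Qed.

Lemma derivable_const (k : C R) z : derivable (fun _ => k) z 1.
Proof. exact: (@derivable_cst _ _ _ k z 1). Qed.

Lemma derivable_ident z : derivable (fun w : C R => w) z 1.
Proof. exact: derivable_id. Qed.

Lemma derivable_pow f n z : derivable f z 1 ->
  derivable (fun w => f w ^+ n) z 1.
Proof.
move=> df; elim: n => [|n IH].
  by under eq_fun do rewrite expr0; exact: derivable_const.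
by under eq_fun do rewrite exprS; exact: derivable_mul.
Qed.

Lemma derivable_near f g z : (\forall w \near z, f w = g w) ->
  derivable f z 1 -> derivable g z 1.
Proof. by move=> fg; exact: near_eq_derivable fg. Qed.

Lemma derive1_near f g z : (\forall w \near z, f w = g w) ->
  derive1 f z = derive1 g z.
Proof. by move=> fg; rewrite !derive1E; exact: near_eq_derive fg. Qed.

(** This filled-in quotient is the integrand to which [goursat_except] is applied in the Cauchy
    formula, and the factor in Carathéodory's form of the derivative. *)
Lemma difference_quotient_continuous f w : derivable f w 1 ->
  (fun z => (if z == w then derive1 f w else (f z - f w) / (z - w)) : C R)
    @ w --> (derive1 f w : C R).
Proof.
move=> df; apply/(@cvg_modulusP _ _ (nbhs w)) => e e0.
have e20 : 0 < e / 2 by rewrite divr_gt0.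
apply: filterS (derivable_approx df e20) => z.
have [->|zw] := eqVneq z w; first by rewrite !subrr modulus0.
have zw0 : z - w != 0 by rewrite subr_eq0.
move=> h.
have -> : derive1 f w - (f z - f w) / (z - w) =
    - (f z - f w - derive1 f w * (z - w)) * (z - w)^-1 by field.
rewrite modulusM modulusN modulusV ltr_pdivrMr ?modulus_gt0 //.
apply: le_lt_trans h _; rewrite ltr_pM2r ?modulus_gt0 //; lra.
Qed.

End Derivability.

(** * Cauchy's integral formula *)

Section CauchyTransform.
Variable R : realType.
Variables (a b c d : R).
Hypotheses (ab : a < b) (cd : c < d).
Implicit Types (f : C R -> C R) (z w : C R).

Let ableq : a <= b := ltW ab.
Let cdleq : c <= d := ltW cd.

Local Notation oint F := (rect_int F a b c d).
Local Notation boundary := (rect_boundary a b c d).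
Local Notation interior := (rect_interior a b c d).
Local Notation bcontinuous := (boundary_continuous a b c d).

Lemma rect_interior_nbhs w : interior w -> \forall w' \near w, interior w'.
Proof.
move=> [/andP[h1 h2] /andP[h3 h4]].
have cR : (fun z : C R => Re z) @ w --> Re w by exact: (cvg_Re (@cvg_id _ (nbhs w))).
have cI : (fun z : C R => Im z) @ w --> Im w by exact: (cvg_Im (@cvg_id _ (nbhs w))).
have n1 : \forall z \near w, a < Re z := cR _ (lt_nbhsr h1).
have n2 : \forall z \near w, Re z < b := cR _ (lt_nbhsl h2).
have n3 : \forall z \near w, c < Im z := cI _ (lt_nbhsr h3).
have n4 : \forall z \near w, Im z < d := cI _ (lt_nbhsl h4).
apply: filterS2 (filterI n1 n2) (filterI n3 n4) => z [/= z1 z2] [/= z3 z4].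
by split; apply/andP.
Qed.

Lemma boundary_sub_neq0 z w : boundary z -> interior w -> z - w != 0.
Proof.
move=> hz [/andP[h1 h2] /andP[h3 h4]]; rewrite subr_eq0; apply/eqP => zw.
by case: hz; rewrite zw => -[_ []] E; move: h1 h2 h3 h4; rewrite E ltxx.
Qed.

Lemma bcontinuousM f g : bcontinuous f -> bcontinuous g ->
  bcontinuous (fun z => f z * g z).
Proof. by move=> cf cg z hz; exact: cvgM (cf z hz) (cg z hz). Qed.

Lemma bcontinuous_kernel w n : interior w ->
  bcontinuous (fun z => ((z - w) ^+ n)^-1).
Proof.
move=> iw z hz; apply: cvgV; first by rewrite expf_neq0 // boundary_sub_neq0.
apply: derivable_cts; apply: derivable_pow; apply: derivable_sub.
  exact: derivable_ident.
exact: derivable_const.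
Qed.

(** The Cauchy integral without the factor [1 / (2 pi i)] for [n = 1], and its derivative in [w] for
    [n = 2]. *)
Definition cauchy_transform f n w := oint (fun z => f z * ((z - w) ^+ n)^-1).

Lemma jcvg_sub w z : 
  (fun p : C R * C R => p.2 - p.1) @ (nbhs w, nbhs z) --> z - w.
Proof. exact: (cvgB cvg_snd cvg_fst). Qed.

Lemma jcvg_inv w z : z - w != 0 ->
  (fun p : C R * C R => (p.2 - p.1)^-1) @ (nbhs w, nbhs z) --> (z - w)^-1.
Proof. by move=> zw; exact: (cvgV zw (@jcvg_sub w z)). Qed.

Lemma bcontinuous_quot f w n : bcontinuous f -> interior w ->
  bcontinuous (fun z => f z * ((z - w) ^+ n)^-1).
Proof. by move=> cf iw; exact: bcontinuousM cf (@bcontinuous_kernel w n iw). Qed.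

Lemma cauchy_transform_derive1 f w : bcontinuous f -> interior w ->
  is_derive w 1 (cauchy_transform f 1) (cauchy_transform f 2 w).
Proof.
move=> cf iw; have niw := rect_interior_nbhs iw.
(* From [1 / (z - w') - 1 / (z - w) = (w' - w) / ((z - w) (z - w'))]. *)
pose L w' z := f z * ((z - w)^-1 * (z - w')^-1).
have -> : cauchy_transform f 2 w = oint (L w).
  by apply: eq_rect_int => // z _; rewrite /L expr2 invfM.
apply: (is_derive_rect_int ab cd (K := fun w' z => f z * ((z - w') ^+ 1)^-1)).
- by apply: filterS niw => w' iw'; exact: (@bcontinuous_quot _ _ _ cf iw').
- apply: filterS niw => w' iw'.
  exact: (bcontinuousM cf (bcontinuousM (@bcontinuous_kernel _ 1 iw)
    (@bcontinuous_kernel _ 1 iw'))).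
- apply: filterS niw => w' iw' z hz; rewrite /L !expr1.
  have h1 := boundary_sub_neq0 hz iw; have h2 := boundary_sub_neq0 hz iw'.
  by field; rewrite h1 h2.
- move=> z hz; rewrite /L; have h1 := boundary_sub_neq0 hz iw.
  have cfz : (fun p : C R * C R => f p.2) @ (nbhs w, nbhs z) --> f z.
    exact: (cvg_comp _ _ cvg_snd (cf z hz)).
  have cz : (fun p : C R * C R => (p.2 - w)^-1) @ (nbhs w, nbhs z) --> (z - w)^-1.
    exact: (cvgV h1 (cvgB cvg_snd (cvg_cst _))).
  exact: (cvgM cfz (cvgM cz (jcvg_inv h1))).
Qed.

(** The integrand is [2 f z / (z - w)^3], in the shape that the difference quotient [L] takes at
    [w' = w]. *)
Lemma cauchy_transform_derive2 f w : bcontinuous f -> interior w ->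
  is_derive w 1 (cauchy_transform f 2)
    (oint (fun z => f z * ((((z - w) + (z - w)) * ((z - w)^-1 * (z - w)^-1)) *
       ((z - w)^-1 * (z - w)^-1)))).
Proof.
move=> cf iw; have niw := rect_interior_nbhs iw.
pose L w' z := f z * ((((z - w) + (z - w')) * ((z - w)^-1 * (z - w)^-1)) *
  ((z - w')^-1 * (z - w')^-1)).
apply: (is_derive_rect_int ab cd (K := fun w' z => f z * ((z - w') ^+ 2)^-1)
  (L := L)).
- by apply: filterS niw => w' iw'; exact: (@bcontinuous_quot _ _ _ cf iw').
- apply: filterS niw => w' iw'.
  have c1 u : interior u -> bcontinuous (fun z => (z - u)^-1).
    by move=> iu; exact: (@bcontinuous_kernel _ 1 iu).
  have c2 (u : C R) : bcontinuous (fun z => z - u).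
    by move=> z _; apply: cvgB; [exact: cvg_id|exact: cvg_cst].
  have c3 : bcontinuous (fun z => (z - w) + (z - w')).
    by move=> z hz; exact: (cvgD (c2 _ z hz) (c2 _ z hz)).
  exact: (bcontinuousM cf
    (bcontinuousM (bcontinuousM c3 (bcontinuousM (c1 _ iw) (c1 _ iw)))
      (bcontinuousM (c1 _ iw') (c1 _ iw')))).
- apply: filterS niw => w' iw' z hz; rewrite /L !expr2.
  have h1 := boundary_sub_neq0 hz iw; have h2 := boundary_sub_neq0 hz iw'.
  by field; rewrite h1 h2.
- move=> z hz; rewrite /L; have h1 := boundary_sub_neq0 hz iw.
  have cfz : (fun p : C R * C R => f p.2) @ (nbhs w, nbhs z) --> f z.
    exact: (cvg_comp _ _ cvg_snd (cf z hz)).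
  have cz : (fun p : C R * C R => p.2 - w) @ (nbhs w, nbhs z) --> z - w.
    exact: (cvgB cvg_snd (cvg_cst _)).
  have cv : (fun p : C R * C R => (p.2 - w)^-1) @ (nbhs w, nbhs z) --> (z - w)^-1.
    exact: (cvgV h1 cz).
  exact: (cvgM cfz (cvgM (cvgM (cvgD cz (@jcvg_sub w z)) (cvgM cv cv))
    (cvgM (jcvg_inv h1) (jcvg_inv h1)))).
Qed.

(* Geometric series step: 1/(z-w) = 1/(z-u) + (w-u)/((z-u)(z-w)). *)
Lemma cauchy_transform_expand f u w : bcontinuous f -> interior u ->
  interior w ->
  cauchy_transform f 1 w = cauchy_transform f 1 u +
    (w - u) * cauchy_transform (fun z => f z * (z - u)^-1) 1 w.
Proof.
move=> cf iu iw; rewrite /cauchy_transform.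
have cu := @bcontinuous_quot _ _ 1 cf iu.
have cuw := @bcontinuous_quot _ _ 1 cu iw.
have ck : bcontinuous (fun z => (w - u) * (f z * (z - u)^-1 * ((z - w) ^+ 1)^-1)).
  by move=> z hz; exact: (cvgM (cvg_cst _) (cuw z hz)).
rewrite -(rect_intZ _ cuw) -(rect_intD cu ck).
apply: eq_rect_int => // z hz; rewrite !expr1.
have h1 := boundary_sub_neq0 hz iu; have h2 := boundary_sub_neq0 hz iw.
by field; rewrite h1 h2.
Qed.

Lemma Im_cint_ge (m x y : R) u : x <= y -> continuous_on x y u ->
  (forall t, x <= t <= y -> m <= Im (u t)) -> m * (y - x) <= Im (cint x y u).
Proof.
move=> xy cu um; rewrite /cint /= -Rintegral_segment_cst //.
apply: le_Rintegral => //.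
- exact: (@continuous_on_Re R x y (fun _ => m%:C) (fun t _ => cvg_cst _)).
- exact: continuous_on_Im.
Qed.

Lemma Re_cint_ge0 (x y : R) u : x <= y -> continuous_on x y u ->
  (forall t, x <= t <= y -> 0 <= Re (u t)) -> 0 <= Re (cint x y u).
Proof.
move=> xy cu um; rewrite /cint /=; apply: Rintegral_ge0 => t /=.
by rewrite in_itv /=; exact: um.
Qed.

Lemma Re_inv z : Re z^-1 = Re z / (Re z ^+ 2 + Im z ^+ 2).
Proof. by case: z. Qed.

Lemma Im_inv z : Im z^-1 = - Im z / (Re z ^+ 2 + Im z ^+ 2).
Proof. by case: z => x y; rewrite mulNr. Qed.

(** The imaginary part of the integral is [Im H + Re V], and every side contributes with the right
    sign: [1 / (z - w)] has positive imaginary part below [w] and negative above, positive real part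
    to the right of [w] and negative to the left. *)
Lemma winding_neq0 w : interior w -> cauchy_transform (fun _ => 1) 1 w != 0.
Proof.
move=> iw; rewrite /cauchy_transform.
have ck : bcontinuous (fun z => 1 * ((z - w) ^+ 1)^-1).
  exact: (@bcontinuous_quot _ _ 1 (fun z _ => cvg_cst _) iw).
have [cc cD ca cb] := boundary_continuous_on ck.
rewrite /rect_int; set H := cint a b _; set V := cint c d _.
suff h : 0 < Im H + Re V.
  apply/eqP => HV; move: h.
  have -> : Im H + Re V = Im (H + 'i * V).
    by rewrite ImD [_ * V]mulrC ImiRe.
  by rewrite HV ltxx.
case: (iw) => /andP[ap pb] /andP[cq qd].
pose p := Re w; pose q := Im w.
have ReE s t : Re (cplx s t - w) = s - p by rewrite ReB.
have ImE s t : Im (cplx s t - w) = t - q by rewrite ImB.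
(* A lower bound for [Im (1 / (z - w))] on the bottom side, from [|s - p| <= b - a]; strict
   positivity is drawn from this side alone. *)
pose m := (q - c) / ((b - a) ^+ 2 + (q - c) ^+ 2).
have qc0 : 0 < q - c by rewrite subr_gt0.
have dq0 : 0 < d - q by rewrite subr_gt0.
have sq0 (x y : R) : 0 < y -> 0 < x ^+ 2 + y ^+ 2.
  by move=> y0; rewrite ltr_wpDl ?sqr_ge0 // exprn_gt0.
have Hm : m * (b - a) <= Im H.
  apply: (Im_cint_ge ableq (continuous_onB cc cD)).
  move=> s /andP[as_ sb]; rewrite !mul1r !expr1.
  rewrite ImB !Im_inv !ReE !ImE.
  have h1 : m <= - (c - q) / ((s - p) ^+ 2 + (c - q) ^+ 2).
    rewrite /m opprB -[c - q]opprB sqrrN ler_pM2l //.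
    rewrite lef_pV2 ?posrE ?sq0 //; nra.
  have h2 : 0 <= (d - q) / ((s - p) ^+ 2 + (d - q) ^+ 2).
    by rewrite ltW // divr_gt0 // sq0.
  by rewrite [X in _ - X]mulNr opprK; lra.
have V0 : 0 <= Re V.
  apply: (Re_cint_ge0 cdleq (continuous_onB cb ca)).
  move=> t /andP[ct td]; rewrite !mul1r !expr1.
  rewrite ReB !Re_inv !ReE !ImE.
  have h1 : 0 <= (b - p) / ((b - p) ^+ 2 + (t - q) ^+ 2).
    by apply: divr_ge0; [rewrite subr_ge0 ltW|rewrite addr_ge0 ?sqr_ge0].
  have h2 : 0 <= - (a - p) / ((a - p) ^+ 2 + (t - q) ^+ 2).
    apply: divr_ge0; first by rewrite opprB subr_ge0 ltW.
    by rewrite addr_ge0 ?sqr_ge0.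
  by rewrite mulNr in h2; lra.
have : 0 < m * (b - a) by rewrite mulr_gt0 ?subr_gt0 // divr_gt0 // sq0.
lra.
Qed.

(** On the boundary, [f z / (z - w) = g z + f w / (z - w)] with [g] the difference quotient at [w],
    and [g] integrates to 0 by Goursat with exceptional point [w]. *)
Lemma cauchy_formula f w : interior w ->
  (forall s t, a <= s <= b -> c <= t <= d -> derivable f (cplx s t) 1) ->
  cauchy_transform f 1 w = f w * cauchy_transform (fun _ => 1) 1 w.
Proof.
move=> iw df.
have dz z : a <= Re z <= b -> c <= Im z <= d -> derivable f z 1.
  by case: z => s t; exact: df.
have dw : derivable f w 1 by case: iw => /andP[? ?] /andP[? ?]; apply: dz; lra.
pose g (z : C R) : C R := if z == w then derive1 f w else (f z - f w) / (z - w).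
have dg z : derivable f z 1 -> z <> w -> derivable g z 1.
  move=> dfz zw; have zw0 : z - w != 0 by rewrite subr_eq0; exact/eqP.
  apply: (@derivable_near _ (fun z => (f z - f w) * (z - w)^-1)).
    have : \forall z' \near z, z' != w.
      apply/nbhs_modulusP; exists (modulus (z - w)); first by rewrite modulus_gt0.
      move=> z'; apply: contraTneq => ->.
      by rewrite modulus_distC ltxx.
    by apply: filterS => z' /negbTE zw'; rewrite /g zw'.
  exact: (derivable_mul (derivable_sub dfz (@derivable_const _ (f w) z))
    (@derivable_inv _ (fun z => z - w) z zw0
      (derivable_sub (@derivable_ident _ z) (@derivable_const _ w z)))).
have g0 : oint g = 0.
  have wab : a < Re w < b by case: iw.
  apply: (goursat_except wab cdleq).
    move=> s t hs ht; have [->|zw] := eqVneq (cplx s t) w.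
      rewrite {2}/g eqxx; exact: difference_quotient_continuous.
    exact: (derivable_cts (dg _ (df s t hs ht) (elimN eqP zw))).
  by move=> s t hs ht zw; exact: (dg _ (df s t hs ht) zw).
have bd z : boundary z -> derivable f z 1.
  by case=> -[h [] E]; apply: dz; rewrite ?E ?h ?lexx ?ableq ?cdleq.
have cf : bcontinuous f by move=> z hz; exact: (derivable_cts (bd z hz)).
have c1 : bcontinuous (fun _ => 1) by move=> z _; exact: cvg_cst.
have cfk := @bcontinuous_quot _ _ 1 cf iw.
have c1k := @bcontinuous_quot _ _ 1 c1 iw.
have cg : bcontinuous g.
  move=> z hz; have zw : z <> w.
    by move=> zw; have := boundary_sub_neq0 hz iw; rewrite zw subrr eqxx.
  exact: (derivable_cts (dg z (bd z hz) zw)).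
have cfw : bcontinuous (fun z => f w * (1 * ((z - w) ^+ 1)^-1)).
  by move=> z hz; exact: (cvgM (cvg_cst _) (c1k z hz)).
rewrite /cauchy_transform -(rect_intZ _ c1k) -[RHS]add0r -g0 -(rect_intD cg cfw).
apply: eq_rect_int => // z hz.
have h1 := boundary_sub_neq0 hz iw.
rewrite /g -subr_eq0 (negbTE h1) expr1; ring.
Qed.

End CauchyTransform.

(** * Local properties of holomorphic functions *)

Section LocalTheory.
Variable R : realType.
Implicit Types (f g : C R -> C R) (z w : C R).

Lemma near_near z (P : C R -> Prop) : (\forall w \near z, P w) ->
  \forall w \near z, \forall w' \near w, P w'.
Proof.
move=> /nbhs_modulusP [r r0 rP]; apply/nbhs_modulusP; exists r => // w wz.
apply/nbhs_modulusP; exists (r - modulus (w - z)); first by rewrite subr_gt0.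
move=> w' ww'; apply: rP; have -> : w' - z = (w' - w) + (w - z) by ring.
by apply: le_lt_trans (modulusD _ _) _; rewrite -ltrBrDr.
Qed.

Lemma near_all z (P : C R -> Prop) : (forall w, P w) -> \forall w \near z, P w.
Proof. by move=> allP; apply/nbhs_modulusP; exists 1. Qed.

Lemma near_neq z w : w != z -> \forall w' \near w, w' != z.
Proof.
move=> wz; apply/nbhs_modulusP; exists (modulus (w - z)).
  by rewrite modulus_gt0 subr_eq0.
by move=> w'; apply: contraTneq => ->; rewrite modulus_distC ltxx.
Qed.

Lemma holomorphic_derivable f z : holomorphic_at f z -> derivable f z 1.
Proof. exact: nbhs_singleton. Qed.

Lemma holomorphic_cts f z : holomorphic_at f z -> f @ z --> f z.
Proof. by move=> hf; exact: derivable_cts (holomorphic_derivable hf). Qed.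

Lemma holomorphic_eq f g z : (\forall w \near z, f w = g w) ->
  holomorphic_at f z -> holomorphic_at g z.
Proof.
move=> /near_near fg hf; apply: filterS2 fg hf => w fgw dfw.
exact: derivable_near fgw dfw.
Qed.

Lemma holomorphic_mul f g z : holomorphic_at f z -> holomorphic_at g z ->
  holomorphic_at (fun w => f w * g w) z.
Proof.
move=> hf hg; apply: filterS2 hf hg => w df dg; exact: derivable_mul df dg.
Qed.

Lemma holomorphic_sub f g z : holomorphic_at f z -> holomorphic_at g z ->
  holomorphic_at (fun w => f w - g w) z.
Proof.
move=> hf hg; apply: filterS2 hf hg => w df dg; exact: derivable_sub df dg.
Qed.

Lemma holomorphic_const (k : C R) z : holomorphic_at (fun _ => k) z.
Proof. by apply: near_all => w; exact: (@derivable_const _ k w). Qed.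

Lemma holomorphic_pow_sub u n z : holomorphic_at (fun w => (w - u) ^+ n) z.
Proof.
apply: near_all => w; exact: (@derivable_pow _ _ n _
  (derivable_sub (@derivable_ident _ w) (@derivable_const _ u w))).
Qed.

Lemma cts_near_neq0 f z : f @ z --> f z -> f z != 0 ->
  \forall w \near z, f w != 0.
Proof.
move=> cf fz0; have := cf _ (near_neq fz0); exact.
Qed.

Lemma holomorphic_inv f z : holomorphic_at f z -> f z != 0 ->
  holomorphic_at (fun w => (f w)^-1) z.
Proof.
move=> hf fz0; have nf := cts_near_neq0 (holomorphic_cts hf) fz0.
apply: filterS2 hf nf => w df fw0; exact: derivable_inv fw0 df.
Qed.

(** Supplies the data of the Cauchy estimates: [M] bounds [f] on the boundary, since [f] varies by
    less than 1 on a small enough disc, and [r] is a lower bound for the distance from [z] to the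
    boundary. *)
Lemma holomorphic_rect f z : holomorphic_at f z ->
  exists a b c d (M r : R), [/\ a < b, c < d, rect_interior a b c d z, 0 < r &
    [/\ forall s t, a <= s <= b -> c <= t <= d -> derivable f (cplx s t) 1,
        forall w, rect_boundary a b c d w -> modulus (f w) <= M &
        forall w, rect_boundary a b c d w -> r <= modulus (w - z)]].
Proof.
move=> hf; have cf := holomorphic_cts hf.
move/(@cvg_modulusP _ _ (nbhs z))/(_ _ ltr01): cf => bf.
have [r r0 rP] : exists2 r : R, 0 < r & forall w, modulus (w - z) < r ->
    derivable f w 1 /\ modulus (f z - f w) < 1.
  by apply/nbhs_modulusP; exact: filterI hf bf.
(* The distance from [z] is at most [2 * h], which has to stay below [r]. *)
pose h := r / 3; have h0 : 0 < h by rewrite divr_gt0.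
have close w : `|Re w - Re z| <= h -> `|Im w - Im z| <= h ->
    modulus (w - z) < r.
  move=> h1 h2; apply: le_lt_trans (modulus_le _) _; rewrite ReB ImB.
  by apply: le_lt_trans (lerD h1 h2) _; rewrite /h; lra.
have dist_le (x y : R) : y - h <= x <= y + h -> `|x - y| <= h.
  by move=> /andP[h1 h2]; rewrite ler_norml; lra.
have bclose w : rect_boundary (Re z - h) (Re z + h) (Im z - h) (Im z + h) w ->
    `|Re w - Re z| <= h /\ `|Im w - Im z| <= h.
  by case=> -[hw []E]; split; apply: dist_le => //; rewrite E; lra.
exists (Re z - h), (Re z + h), (Im z - h), (Im z + h), (modulus (f z) + 1), h.
split=> //; [lra|lra|split; lra|split].
- move=> s t hs ht.
  by have [] := rP (cplx s t) (close (cplx s t) (dist_le _ _ hs) (dist_le _ _ ht)).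
- move=> w /bclose [h1 h2]; have [_ /ltW fw] := rP w (close _ h1 h2).
  have -> : f w = f z - (f z - f w) by ring.
  by apply: le_trans (modulusB _ _) _; rewrite lerD2l.
- move=> w; case=> -[_ []] E.
  + apply: le_trans (Im_le_modulus _); rewrite ImB E.
    by rewrite addrAC subrr sub0r normrN gtr0_norm.
  + apply: le_trans (Im_le_modulus _); rewrite ImB E.
    by rewrite addrAC subrr add0r gtr0_norm.
  + apply: le_trans (Re_le_modulus _); rewrite ReB E.
    by rewrite addrAC subrr sub0r normrN gtr0_norm.
  + apply: le_trans (Re_le_modulus _); rewrite ReB E.
    by rewrite addrAC subrr add0r gtr0_norm.
Qed.

Lemma bcontinuous1 a b c d : boundary_continuous a b c d (fun _ => 1 : C R).
Proof. by move=> w _; exact: cvg_cst. Qed.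

Lemma bcontinuous_derivable a b c d f : a < b -> c < d ->
  (forall s t, a <= s <= b -> c <= t <= d -> derivable f (cplx s t) 1) ->
  boundary_continuous a b c d f.
Proof.
move=> ab cd df [s t] hz; apply: (derivable_cts (df s t _ _)).
  by case: hz => -[/= hw []E]; rewrite ?E ?hw ?lexx ?ltW.
by case: hz => -[/= hw []E]; rewrite ?E ?hw ?lexx ?ltW.
Qed.

(** Differentiating [f * T one 1 = T f 1] gives [T f 2 = f * T one 2 + T one 1 * f']. Solved for
    [f'], this involves only [f] and transforms already known to be derivable. *)
Lemma holomorphic_derive1 f z : holomorphic_at f z ->
  holomorphic_at (derive1 f) z.
Proof.
move=> hf.
have [a [b [c [d [M [r [ab cd iz r0 [df fM rz]]]]]]]] := holomorphic_rect hf.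
have cf := bcontinuous_derivable ab cd df.
have c1 := @bcontinuous1 a b c d.
have niz := rect_interior_nbhs iz.
pose T := cauchy_transform a b c d.
pose one (_ : C R) : C R := 1.
have dT1 g w : boundary_continuous a b c d g -> rect_interior a b c d w ->
    is_derive w 1 (T g 1%N) (T g 2%N w).
  by move=> cg iw; exact: cauchy_transform_derive1.
have dT2 g w : boundary_continuous a b c d g -> rect_interior a b c d w ->
    derivable (T g 2%N) w 1.
  by move=> cg iw; have [] := cauchy_transform_derive2 ab cd cg iw.
apply: (@holomorphic_eq (fun w => (T f 2%N w - f w * T one 2%N w) * (T one 1%N w)^-1)).
  apply: filterS2 niz hf => w iw dfw.
  have W0 : T one 1%N w != 0 by exact: winding_neq0.
  have dW := dT1 one w c1 iw; have dTf := dT1 f w cf iw.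
  have E : 'D_1 (f * T one 1%N) w = T f 2%N w.
    rewrite -(@derive_val _ _ _ _ _ _ _ dTf).
    apply: near_eq_derive.
    apply: filterS (rect_interior_nbhs iw) => w' iw'.
    by rewrite /T (cauchy_formula ab cd iw' df).
  have dWd : derivable (T one 1%N) w 1 by have [] := dW.
  move: E; rewrite (deriveM dfw dWd).
  rewrite (@derive_val _ _ _ _ _ _ _ dW) -derive1E => E.
  have -> : T f 2%N w = f w * T one 2%N w + T one 1%N w * derive1 f w.
    exact: esym E.
  by rewrite [_ + T _ _ _ * _]addrC addrK mulrAC mulfV // mul1r.
have hT2 g : boundary_continuous a b c d g -> holomorphic_at (T g 2%N) z.
  by move=> cg; apply: filterS niz => w iw; exact: dT2.
apply: holomorphic_mul.
  apply: holomorphic_sub; first exact: hT2 cf.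
  exact: holomorphic_mul hf (hT2 _ c1).
apply: holomorphic_inv; last exact: winding_neq0.
by apply: filterS niz => w iw; have [] := dT1 one w c1 iw.
Qed.

(** The [G n z] are the Taylor coefficients of [f * W] at [z], and [(w - z) ^+ n * G n w] is the
    remainder. Either one of them is nonzero, and the first such gives the order, or Cauchy
    estimates force [f * W], hence [f], to vanish near [z]. *)
Lemma holomorphic_order f z : holomorphic_at f z ->
  (\forall w \near z, f w = 0) \/
  exists n g, [/\ holomorphic_at g z, g z != 0 &
    \forall w \near z, f w = (w - z) ^+ n * g w].
Proof.
move=> hf.
have [a [b [c [d [M [r [ab cd iz r0 [df fM rz]]]]]]]] := holomorphic_rect hf.
have cf := bcontinuous_derivable ab cd df.
have c1 := @bcontinuous1 a b c d.
have niz := rect_interior_nbhs iz.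
pose phi n w := f w * ((w - z)^-1) ^+ n.
have cphi n : boundary_continuous a b c d (phi n).
  elim: n => [|n IH].
    suff -> : phi 0%N = f by exact: cf.
    by apply/funext => w; rewrite /phi expr0 mulr1.
  suff -> : phi n.+1 = fun w => phi n w * ((w - z) ^+ 1)^-1.
    exact: (bcontinuousM IH (@bcontinuous_kernel _ a b c d z 1 iz)).
  by apply/funext => w; rewrite /phi expr1 exprSr mulrA.
pose G n := cauchy_transform a b c d (phi n) 1.
pose W := cauchy_transform a b c d (fun _ => 1) 1.
have hG n : holomorphic_at (G n) z.
  apply: filterS niz => w iw.
  by have [] := cauchy_transform_derive1 ab cd (cphi n) iw.
have hW : holomorphic_at W z.
  apply: filterS niz => w iw.
  by have [] := cauchy_transform_derive1 ab cd c1 iw.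
have W0 w : rect_interior a b c d w -> W w != 0 by exact: winding_neq0.
have GS n w : rect_interior a b c d w -> G n w = G n z + (w - z) * G n.+1 w.
  move=> iw; rewrite /G (cauchy_transform_expand (cphi n) iz iw).
  congr (_ + _ * _); apply: eq_rect_int => // u hu.
  by rewrite /phi [_ ^+ n.+1]exprSr [f u * (_ * _)]mulrA.
have Gpow n : (forall m, (m < n)%N -> G m z = 0) ->
    forall w, rect_interior a b c d w -> f w * W w = (w - z) ^+ n * G n w.
  elim: n => [|n IH] Gz w iw.
    rewrite mul1r -(cauchy_formula ab cd iw df).
    by apply: eq_rect_int => // u hu; rewrite /phi expr0 mulr1.
  rewrite IH //; last by move=> m mn; apply: Gz; exact: ltnW.
  by rewrite GS // Gz // add0r exprSr mulrA.
have [Gz|/existsNP Gz] := pselect (forall n, G n z = 0).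
  left.
  (* Half the radius: [|w - z|^n] against the factor [r^-n] in the bound of [G n w] leaves the
     geometric decay [2^-n]. *)
  have nr : \forall w \near z, modulus (w - z) < r / 2.
    by apply/nbhs_modulusP; exists (r / 2) => //; rewrite divr_gt0.
  apply: filterS2 niz nr => w iw wr.
  suff E : f w * W w = 0 by have := mulf_eq0 (f w) (W w); rewrite E eqxx (negbTE (W0 w iw)) orbF => /esym/eqP.
  apply/eqP; rewrite -modulus_eq0 eq_le modulus_ge0 andbT.
  (* The factor 4 and the side lengths come from [modulus_rect_int], and [2 / r] bounds
     [1 / |u - w|] on the boundary. *)
  pose K := 4 * (M * (2 / r) * ((b - a) + (d - c))).
  apply/ler_addgt0Pr => e e0; rewrite add0r.
  have [n nP] := half_pow_small K e0.
  apply: le_trans (ltW nP).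
  rewrite (Gpow n) // modulusM modulusX.
  have phiM u : rect_boundary a b c d u ->
      modulus (phi n u * ((u - w) ^+ 1)^-1) <= M * (r^-1) ^+ n * (2 / r).
    move=> hu; have ru := rz u hu.
    have rw : r / 2 <= modulus (u - w).
      have := modulusD (u - w) (w - z).
      have -> : u - w + (w - z) = u - z by ring.
      lra.
    rewrite /phi expr1 !modulusM modulusX !modulusV.
    have u0 : 0 < modulus (u - z) by exact: lt_le_trans ru.
    have w0 : 0 < modulus (u - w) by apply: lt_le_trans rw; rewrite divr_gt0.
    apply: ler_pM.
    - by rewrite mulr_ge0 ?modulus_ge0 // exprn_ge0 // invr_ge0 modulus_ge0.
    - by rewrite invr_ge0 modulus_ge0.
    - apply: ler_pM; [exact: modulus_ge0| |exact: fM|].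
        by rewrite exprn_ge0 // invr_ge0 modulus_ge0.
      by rewrite lerXn2r ?nnegrE ?invr_ge0 ?modulus_ge0 ?(ltW r0) // lef_pV2.
    - by rewrite -invf_div lef_pV2 // posrE divr_gt0.
  have cq := @bcontinuous_quot _ a b c d _ _ 1 (cphi n) iw.
  have GM := modulus_rect_int ab cd cq phiM.
  have -> : K / 2 ^+ n = (r / 2) ^+ n *
      (4 * (M * r^-1 ^+ n * (2 / r) * (b - a + (d - c)))).
    rewrite /K exprMn exprVn exprVn; field.
    by rewrite !expf_neq0 // gt_eqF.
  apply: ler_pM; [by rewrite exprn_ge0 // modulus_ge0|exact: modulus_ge0| |exact: GM].
  by rewrite lerXn2r ?nnegrE ?modulus_ge0 ?ltW // divr_gt0.
right; pose bad n := G n z != 0.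
have exn : exists n, bad n by have [n /eqP nP] := Gz; exists n.
pose n := ex_minn exn.
have [nz nmin] : bad n /\ forall m, bad m -> (n <= m)%N.
  by rewrite /n; case: ex_minnP.
exists n, (fun w => G n w * (W w)^-1); split.
- exact: holomorphic_mul (hG n) (holomorphic_inv hW (W0 z iz)).
- by rewrite mulf_neq0 // invr_eq0 W0.
- apply: filterS niz => w iw.
  rewrite mulrA -(Gpow n) //; first by rewrite mulfK // W0.
  by move=> m mn; apply/eqP; apply: contraTT mn => /nmin; rewrite -leqNgt.
Qed.

(** If [f] is not locally constant, [f w = f z + (w - z)^n g w] with [n > 0]. Along a direction [u]
    with [u^n = f z / g z], the leading term at [z + t u] is [t^n f z], so the modulus gains
    [t^n |f z|] up to an error of at most half of that. *)
Lemma holomorphic_max_modulus f z : holomorphic_at f z ->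
  (\forall w \near z, modulus (f w) <= modulus (f z)) ->
  \forall w \near z, f w = f z.
Proof.
move=> hf fmax.
have [fz0|fz0] := eqVneq (f z) 0.
  apply: filterS fmax => w; rewrite fz0 modulus0 => fw0.
  by apply/eqP; rewrite -modulus_eq0 eq_le fw0 modulus_ge0.
have hfz := holomorphic_sub hf (@holomorphic_const (f z) z).
have [E|[n [g [hg gz0 E]]]] := holomorphic_order hfz.
  by apply: filterS E => w /eqP; rewrite subr_eq0 => /eqP.
exfalso.
have n0 : (0 < n)%N.
  case: n E => // /nbhs_singleton; rewrite subrr mul1r => gz.
  by rewrite -gz eqxx in gz0.
pose q := f z / g z; have q0 : q != 0 by rewrite mulf_neq0 // invr_eq0.
pose u : C R := n.-root q.
have un : u ^+ n = q by exact: rootCK.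
have e0 : 0 < modulus (g z) / 2 by rewrite divr_gt0 // modulus_gt0.
move/(@cvg_modulusP _ _ (nbhs z))/(_ _ e0): (holomorphic_cts hg) => ng.
have [r r0 rP] : exists2 r : R, 0 < r & forall w, modulus (w - z) < r ->
    [/\ modulus (f w) <= modulus (f z), f w - f z = (w - z) ^+ n * g w &
        modulus (g z - g w) < modulus (g z) / 2].
  by apply/nbhs_modulusP; apply: filterS3 fmax E ng => w; split.
pose t := r / (2 * (modulus u + 1)).
have u1 : 0 < modulus u + 1 by rewrite ltr_wpDl // modulus_ge0.
have t0 : 0 < t by rewrite divr_gt0 // mulr_gt0.
have tu : modulus ((z + t%:C * u) - z) < r.
  rewrite addrAC subrr add0r modulusM modulus_real gtr0_norm // /t.
  rewrite mulrAC ltr_pdivrMr ?mulr_gt0 // ltr_pM2l //.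
  have := modulus_ge0 u; lra.
have [h1 h2 h3] := rP _ tu; set w := z + _ in h1 h2 h3.
pose x := t ^+ n; have x0 : 0 < x by rewrite exprn_gt0.
have wz : (w - z) ^+ n = x%:C * q.
  by rewrite /w addrAC subrr add0r exprMn un rmorphXn.
have fw : f w = f z * (1 + x%:C) - x%:C * q * (g z - g w).
  have -> : f w = (f w - f z) + f z by ring.
  by rewrite h2 wz /q; field.
have : modulus (f z) * (1 + x) - x * (modulus (f z) / 2) <= modulus (f w).
  have -> : modulus (f z) * (1 + x) = modulus (f z * (1 + x%:C)).
    rewrite modulusM -(rmorph1 (real_complex R)) -rmorphD modulus_real gtr0_norm //.
    by rewrite addr_gt0.
  have -> : f z * (1 + x%:C) = f w + x%:C * q * (g z - g w) by rewrite fw subrK.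
  rewrite lerBlDr; apply: le_trans (modulusD _ _) _; rewrite lerD2l.
  rewrite !modulusM modulus_real gtr0_norm // -mulrA ler_pM2l //.
  rewrite modulusV mulrAC ler_pdivrMr ?modulus_gt0 // -mulrA.
  by rewrite ler_wpM2l ?modulus_ge0 // mulrC; lra.
have := modulus_gt0 (f z); rewrite fz0; nra.
Qed.

End LocalTheory.

(** * Derivative formulas and punctured neighbourhoods *)

Section DerivativeRules.
Variable R : realType.
Implicit Types (f g : C R -> C R) (z w u : C R).

Lemma derive1_mul f g z : derivable f z 1 -> derivable g z 1 ->
  derive1 (fun w => f w * g w) z = f z * derive1 g z + g z * derive1 f z.
Proof. by move=> df dg; rewrite !derive1E; exact: (deriveM df dg). Qed.

Lemma derive1_const (k z : C R) : derive1 (fun _ : C R => k) z = 0.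
Proof. by rewrite derive1E; exact: derive_cst. Qed.

Lemma derive1_sub_const u z : derive1 (fun w => w - u) z = 1.
Proof.
have n1 : \forall w \near z, (w - u) - (z - u) = (w - z) * 1.
  by apply: near_all => w; rewrite mulr1; ring.
have c1 : (fun _ : C R => 1 : C R) @ z --> (1 : C R) by exact: cvg_cst.
have d1 := @is_derive_quotient _ _ (fun _ => 1) z n1 c1.
by rewrite derive1E (@derive_val _ _ _ _ _ _ _ d1).
Qed.

Lemma derivable_pow_sub u n z : derivable (fun w => (w - u) ^+ n) z 1.
Proof. exact: holomorphic_derivable (@holomorphic_pow_sub _ u n z). Qed.

Lemma derive1_pow_sub u n z :
  derive1 (fun w => (w - u) ^+ n.+1) z = n.+1%:R * (z - u) ^+ n.
Proof.
elim: n => [|n IH]; first by rewrite expr0 mulr1; exact: derive1_sub_const.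
have -> : (fun w => (w - u) ^+ n.+2) = (fun w => (w - u) * (w - u) ^+ n.+1).
  by apply/funext => w; rewrite exprS.
rewrite derive1_mul; first last.
- exact: derivable_pow_sub.
- exact: (@derivable_pow_sub u 1 z).
by rewrite IH derive1_sub_const [in RHS]exprS -[in RHS]natr1 exprS; ring.
Qed.

Lemma caratheodory f z : derivable f z 1 ->
  exists L : C R -> C R, [/\ forall w, f w - f z = (w - z) * L w,
    L z = derive1 f z & L @ z --> L z].
Proof.
move=> df; have := difference_quotient_continuous df.
set L := (X in X @ _ --> _) => cL.
have Lz : L z = derive1 f z by rewrite /L eqxx.
exists L; split; [|exact: Lz|rewrite Lz; exact: cL].
move=> w; rewrite /L; have [->|wz] := eqVneq w z; first by rewrite !subrr mul0r.
by rewrite mulrC divfK // subr_eq0.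
Qed.

(** The product of the Carathéodory factors is one for [f \o g], including at points where
    [g w = g z]. *)
Lemma chain_rule f g z : derivable g z 1 -> derivable f (g z) 1 ->
  derive1 (f \o g) z = derive1 f (g z) * derive1 g z.
Proof.
move=> dg df; have [Lg [gL Lgz cLg]] := caratheodory dg.
have [Lf [fL Lfz cLf]] := caratheodory df.
pose L w := Lf (g w) * Lg w.
have cL : L @ z --> L z.
  exact: (cvgM (cvg_comp _ _ (derivable_cts dg) cLf) cLg).
have n1 : \forall w \near z, (f \o g) w - (f \o g) z = (w - z) * L w.
  by apply: near_all => w; rewrite /= fL gL /L; ring.
have d1 := is_derive_quotient n1 cL.
by rewrite derive1E (@derive_val _ _ _ _ _ _ _ d1) /L Lfz Lgz.
Qed.

Lemma near_punctured z (P : C R -> Prop) :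
  (\forall w \near z, w != z -> P w) -> exists2 w, w != z & P w.
Proof.
move=> /nbhs_modulusP [r r0 rP].
have wz : z + (r / 2)%:C - z = (r / 2)%:C by rewrite addrAC subrr add0r.
have r20 : 0 < r / 2 by rewrite divr_gt0.
have wDz : z + (r / 2)%:C != z.
  by rewrite -subr_eq0 wz -modulus_eq0 modulus_real gtr0_norm // gt_eqF.
exists (z + (r / 2)%:C) => //; apply: rP => //.
by rewrite wz modulus_real gtr0_norm //; lra.
Qed.

(** Allows an identity valid on a punctured neighbourhood to be differentiated at each point of
    it. *)
Lemma near_punctured_near z (P : C R -> Prop) :
  (\forall w \near z, w != z -> P w) ->
  \forall w \near z, w != z -> \forall w' \near w, P w'.
Proof.
move=> /near_near; apply: filterS => w Pw wz.
by apply: filterS2 Pw (near_neq wz) => w' h1 h2; exact: h1.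
Qed.

End DerivativeRules.

(** * Compact Riemann surfaces *)

Section Surface.
Variables (R : realType) (X : riemannSurface R).
Implicit Types (x : X) (c : chart R X) (f h : X -> C R).

Lemma chart_dom_near x c : chart_dom c x -> \forall y \near x, chart_dom c y.
Proof. by move=> cx; apply: open_nbhs_nbhs; split => //; exact: chart_open_dom. Qed.

Lemma chart_cts x c : chart_dom c x -> c y @[y --> x] --> c x.
Proof.
move=> cx; have := @chart_map_cont _ _ c.
rewrite continuous_open_subspace; last exact: chart_open_dom.
by move=> /(_ x); apply; rewrite inE.
Qed.

Lemma chart_im_near x c : chart_dom c x ->
  \forall w \near c x, chart_dom c (chart_inv c w) /\ c (chart_inv c w) = w.
Proof.
move=> cx.
have : nbhs (c x) (c @` chart_dom c).
  apply: open_nbhs_nbhs; split; first exact: chart_open_im.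
  by exists x.
apply: filterS => _ [y cy <-].
by rewrite (chart_mapK cy).
Qed.

Lemma chart_inv_cts x c : chart_dom c x ->
  chart_inv c w @[w --> c x] --> x.
Proof.
move=> cx; have := @chart_inv_cont _ _ c.
rewrite continuous_open_subspace; last exact: chart_open_im.
move=> /(_ (c x)) icts.
have : chart_inv c w @[w --> c x] --> chart_inv c (c x).
  by apply: icts; rewrite inE; exists x.
by rewrite (chart_mapK cx).
Qed.

Lemma near_chart x c (P : X -> Prop) : chart_dom c x ->
  (\forall w \near c x, P (chart_inv c w)) -> \forall y \near x, P y.
Proof.
move=> cx Pw; have n1 := chart_cts cx Pw.
apply: filterS2 (chart_dom_near cx) n1 => y cy /=.
by rewrite (chart_mapK cy).
Qed.

Lemma chart_near x c (P : X -> Prop) : chart_dom c x ->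
  (\forall y \near x, P y) -> \forall w \near c x, P (chart_inv c w).
Proof. by move=> cx Py; have := chart_inv_cts cx Py; exact. Qed.

Lemma near_neq_surface x y : x <> y -> \forall x' \near x, x' <> y.
Proof.
move=> xy.
have cy : closed [set y].
  exact: (accessible_closed_set1 (hausdorff_accessible (@rs_hausdorff _ X))).
have := closed_openC cy; rewrite openE => /(_ x) h.
by have : interior (~` [set y]) x by apply: h.
Qed.

(** One chart at each point is enough for continuity and the maximum principle, and it leaves the
    choice of a convenient chart when a function is built piecewise. *)
Definition holomorphic_surface h :=
  forall x, exists2 c, chart_at x c & holomorphic_at (h \o chart_inv c) (c x).

Lemma holomorphic_surface_cts h x : holomorphic_surface h -> h @ x --> h x.
Proof.
move=> /(_ x) [c [_ cx] /holomorphic_cts hc].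
rewrite /= (chart_mapK cx) in hc => A /hc hA.
by have := @near_chart x c (fun y => A (h y)) cx hA.
Qed.

Lemma holomorphic_surface_max h x : holomorphic_surface h ->
  (forall y, modulus (h y) <= modulus (h x)) ->
  \forall y \near x, h y = h x.
Proof.
move=> hh hmax; have [c [_ cx] hc] := hh x.
apply: (near_chart cx).
have := holomorphic_max_modulus hc; rewrite /= (chart_mapK cx); apply.
by apply: near_all => w; exact: hmax.
Qed.

Lemma compact_modulus_max h (x0 : X) : compact [set: X] -> holomorphic_surface h ->
  exists x, forall y, modulus (h y) <= modulus (h x).
Proof.
move=> cX hh.
have ch : {within [set: X], continuous (fun x => modulus (h x))}.
  apply: continuous_subspaceT => x.
  exact: cvg_modulus (@holomorphic_surface_cts h x hh).
have [|x _ xmax] := compact_EVT_max _ cX ch; first by exists x0.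
by exists x => y; apply: xmax; rewrite inE.
Qed.

(** With [x1] a point of maximal modulus, the set where [h = h x1] is open by the maximum principle,
    closed by continuity, and so all of the connected [X]. *)
Lemma compact_holomorphic_const h (x0 : X) : compact [set: X] ->
  holomorphic_surface h -> forall x, h x = h x0.
Proof.
move=> cX hh; have [x1 x1max] := compact_modulus_max x0 cX hh.
suff AT : [set x | h x = h x1] = [set: X].
  have allx x : h x = h x1 by have : [set: X] x by []; rewrite -AT.
  by move=> x; rewrite !allx.
have := @rs_connected _ X; apply; first by exists x1.
- exists [set x | h x = h x1]; last by rewrite setTI.
  rewrite openE => x /= hx.
  have := @holomorphic_surface_max h x hh; rewrite hx; exact.
- exists [set x | h x = h x1]; last by rewrite setTI.
  rewrite -[X in closed X]setCK; apply: open_closedC.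
  rewrite openE => x /= /eqP hx.
  have n1 : \forall y \near x, h y != h x1.
    exact: (@holomorphic_surface_cts h x hh _ (near_neq hx)).
  by apply: filterS n1 => y /eqP.
Qed.

End Surface.

(** * Isolated singularities of finite order *)

(** The order [k] of [g] decides: for [n <= k], or [g] zero near [z], the singularity is removable;
    otherwise it is a pole of order [n - k], and [1 / F'] has a zero of order [n - k + 1]. *)
Lemma removable_or_pole (R : realType) (F g : C R -> C R) (z : C R) (n : nat) :
  holomorphic_at g z ->
  (\forall w \near z, w != z -> (w - z) ^+ n * F w = g w) ->
  (\forall w \near z, w != z -> derivable F w 1) ->
  (exists2 G, holomorphic_at G z & \forall w \near z, w != z -> F w = G w) \/
  (exists Q, [/\ holomorphic_at Q z, Q z = 0 &
     \forall w \near z, w != z -> (derive1 F w)^-1 = Q w]).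
Proof.
move=> hg Fg dF.
have sub0 (w : C R) : w != z -> w - z != 0 by rewrite subr_eq0.
have [g0|[k [g1 [hg1 g1z gE]]]] := holomorphic_order hg.
  left; exists (fun _ => 0); first exact: holomorphic_const.
  apply: filterS2 Fg g0 => w + gw0 wz => /(_ wz); rewrite gw0 => /eqP.
  by rewrite mulf_eq0 expf_eq0 (negbTE (sub0 w wz)) andbF => /eqP.
have [nk|kn] := leqP n k.
  left; exists (fun w => (w - z) ^+ (k - n) * g1 w).
    exact: holomorphic_mul (@holomorphic_pow_sub _ z _ z) hg1.
  apply: filterS2 Fg gE => w + gw wz => /(_ wz); rewrite gw => E.
  have h0 : (w - z) ^+ n != 0 by rewrite expf_neq0 // sub0.
  by apply: (mulfI h0); rewrite E mulrA -exprD subnKC.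
(* The pole order is written [m.+1] to fit [derive1_pow_sub]. *)
right; pose m := (n - k).-1.
have mE : n = (k + m.+1)%N by rewrite /m prednK ?subn_gt0 // subnKC // ltnW.
have FE : \forall w \near z, w != z -> (w - z) ^+ m.+1 * F w = g1 w.
  apply: filterS2 Fg gE => w + gw wz => /(_ wz); rewrite gw => E.
  have h0 : (w - z) ^+ k != 0 by rewrite expf_neq0 // sub0.
  by apply: (mulfI h0); rewrite -E mulrA -exprD -mE.
(* The numerator of [F'] over [(w - z) ^+ m.+2], by differentiating
   [(w - z) ^+ m.+1 * F w = g1 w]. *)
pose q w := (w - z) ^+ 1 * derive1 g1 w - m.+1%:R * g1 w.
have hq : holomorphic_at q z.
  apply: holomorphic_sub.
    exact: holomorphic_mul (@holomorphic_pow_sub _ z 1 z) (holomorphic_derive1 hg1).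
  exact: holomorphic_mul (@holomorphic_const _ m.+1%:R z) hg1.
have qz : q z != 0.
  by rewrite /q subrr mul0r sub0r oppr_eq0 mulf_neq0 // pnatr_eq0.
exists (fun w => (w - z) ^+ m.+2 * (q w)^-1); split.
- exact: holomorphic_mul (@holomorphic_pow_sub _ z m.+2 z) (holomorphic_inv hq qz).
- by rewrite subrr expr0n mul0r.
have nq := cts_near_neq0 (holomorphic_cts hq) qz.
apply: filterS3 (near_punctured_near FE) (filterI FE nq) dF.
move=> w nFE [FEw qw] dFw wz; have := dFw wz; have := FEw wz.
move=> {}FEw {}dFw; have w0 := sub0 w wz.
have dE : derive1 g1 w =
    (w - z) ^+ m.+1 * derive1 F w + F w * (m.+1%:R * (w - z) ^+ m).
  rewrite -derive1_pow_sub -(derive1_mul (@derivable_pow_sub _ z m.+1 w) dFw).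
  by apply: derive1_near; apply: filterS (nFE wz) => w' ->.
have qE : q w = (w - z) ^+ m.+2 * derive1 F w.
  by rewrite /q dE -FEw !exprS expr0; ring.
have h0 : (w - z) ^+ m.+2 != 0 by rewrite expf_neq0.
by rewrite qE invfM mulrA mulfV // mul1r.
Qed.

(** * The differential of a function in charts *)

Section Differential.
Variables (R : realType) (X : riemannSurface R).
Implicit Types (x : X) (c : chart R X) (f : X -> C R).

(** The chain rule for the transition map. It makes the vanishing of [df] at a point independent of
    the chart and gives [df] the transformation rule of a form. *)
Lemma differential_transition f x c c' : chart_at x c -> chart_at x c' ->
  holomorphic_at (f \o chart_inv c') (c' x) ->
  differential f c x =
  differential f c' x * derive1 (c' \o chart_inv c) (c x).
Proof.
move=> [ac cx] [ac' cx'] hf; rewrite /differential.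
have dT := holomorphic_derivable (rs_compat ac ac' cx cx').
have Tx : (c' \o chart_inv c) (c x) = c' x by rewrite /= (chart_mapK cx).
have df : derivable (f \o chart_inv c') ((c' \o chart_inv c) (c x)) 1.
  by rewrite Tx; exact: holomorphic_derivable hf.
have E := chain_rule dT df; rewrite Tx in E; rewrite -E; apply: derive1_near.
have n1 := chart_near cx (chart_dom_near cx').
by apply: filterS n1 => w cw /=; rewrite (chart_mapK cw).
Qed.

Lemma near_chart_at x c : chart_at x c ->
  \forall w \near c x, chart_at (chart_inv c w) c /\ c (chart_inv c w) = w.
Proof. by move=> [ac cx]; apply: filterS (chart_im_near cx) => w []. Qed.

Lemma near_chart_neq x c (y : X) : chart_dom c x -> x <> y ->
  \forall w \near c x, chart_inv c w <> y.
Proof. by move=> cx xy; have := chart_near cx (near_neq_surface xy); exact. Qed.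

Lemma near_chart_punctured x c : chart_dom c x ->
  \forall w \near c x, w != c x -> chart_inv c w <> x.
Proof.
move=> cx; apply: filterS (chart_im_near cx) => w [_ cw] /eqP wz ix.
by apply: wz; rewrite -cw ix.
Qed.

End Differential.

(** * The quotient of a holomorphic form by [df] *)

Theorem proposition1p2 (R : realType) (X : riemannSurface R) (g : nat)
    (x0 : X) (f : X -> C R) :
  compact [set: X]%classic -> has_genus X g -> (1 <= g)%N ->
  algebraic_function x0 f ->
  exists x : X, x <> x0 /\ critical_point f x.
Proof.
move=> cX [w [hw wfree _]] g_gt0 [fhol [Fm [merF FmE]]].
apply: contrapT => nocrit.
(* A critical point requires vanishing in every chart; by the transition rule vanishing in one chart
   is enough, so [df] is nonzero in all of them. *)
have D0 x c : x <> x0 -> chart_at x c -> differential f c x != 0.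
  move=> xx0 cx; apply/eqP => Dc0; apply: nocrit; exists x.
  split; [exact: xx0|move=> c' cx'].
  by rewrite (differential_transition cx' cx (fhol x c xx0 cx)) Dc0 mul0r.
have [c0 a0 d0] := rs_cover x0.
have chart0 : chart_at x0 c0 by [].
pose z0 := c0 x0; pose F := f \o chart_inv c0.
have n0 := near_chart_punctured d0.
have n1 := near_chart_at chart0.
have hF : \forall u \near z0, u != z0 -> holomorphic_at F u.
  apply: filterS2 n0 n1 => u iu [cu cuE] uz.
  by have := fhol _ _ (iu uz) cu; rewrite cuE.
have [n [gm [hgm gmE]]] := merF x0 c0 chart0.
have FE : \forall u \near z0, u != z0 -> (u - z0) ^+ n * F u = gm u.
  move: gmE; rewrite /dnbhs near_withinE => gmE.
  apply: filterS2 n0 gmE => u iu gu uz.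
  by rewrite -(gu uz) /= (FmE _ (iu uz)).
have dF : \forall u \near z0, u != z0 -> derivable F u 1.
  by apply: filterS hF => u hu uz; exact: holomorphic_derivable (hu uz).
have [[G hG FG]|[Q [hQ Qz FQ]]] := removable_or_pole hgm FE dF.
  (* The value [f x0] is arbitrary; it is replaced by that of the holomorphic extension. *)
  pose f1 x := if `[< x = x0 >] then G z0 else f x.
  have f1E x : x <> x0 -> f1 x = f x by move=> xx0; rewrite /f1 asboolF.
  have f10 : f1 x0 = G z0 by rewrite /f1 asboolT.
  have hf1 : holomorphic_surface f1.
    move=> x; have [->|xx0] := pselect (x = x0).
      exists c0; first exact: chart0.
      apply: (@holomorphic_eq _ G _ z0 _ hG).
      apply: filterS2 n0 FG => u iu FGu; have [->|uz] := eqVneq u z0.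
        by rewrite /= (chart_mapK d0) f10.
      by rewrite /= (f1E _ (iu uz)) -(FGu uz).
    have [c ac cx] := rs_cover x; have cxa : chart_at x c by [].
    exists c; first exact: cxa.
    apply: (@holomorphic_eq _ (f \o chart_inv c) _ _ _ (fhol x c xx0 cxa)).
    by apply: filterS (near_chart_neq cx xx0) => u iu; rewrite /= f1E.
  (* A point of [X] other than [x0] is taken from the chart at [x0]; around it [f] is constant,
     against [D0]. *)
  have [u uz iu] := near_punctured n0.
  set x := chart_inv c0 u in iu.
  have [c ac cx] := rs_cover x.
  have cxa : chart_at x c by [].
  have := D0 x c iu cxa; rewrite /differential.
  have nE : \forall v \near c x, (f \o chart_inv c) v = G z0.
    apply: filterS (near_chart_neq cx iu) => v iv /=.
    by rewrite -(f1E _ iv) -f10; exact: compact_holomorphic_const.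
  by rewrite (derive1_near nE) derive1_const eqxx.
have exc (x : X) : exists c, chart_at x c by have [c ac cx] := rs_cover x; exists c.
(* Defining [h] as a function requires a definite chart at each point; [hE] shows that the choice
   does not affect the value. *)
have [pc pcP] := choice exc.
pose omega := w (Ordinal g_gt0).
have [omT omH] : holomorphic_form omega by exact: hw.
pose h x := if `[< x = x0 >] then 0
  else omega (pc x) x / differential f (pc x) x.
have h0 : h x0 = 0 by rewrite /h asboolT.
have hE x c : x <> x0 -> chart_at x c -> h x = omega c x / differential f c x.
  move=> xx0 cx; rewrite /h (asboolF xx0).
  have DE := differential_transition (pcP x) cx (fhol x c xx0 cx).
  have Dp := D0 x _ xx0 (pcP x).
  rewrite (omT x (pc x) c (pcP x) cx) DE.
  (* The common transition factor can be cancelled: were it 0, [df] would vanish in the chart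
     [pc x]. *)
  have t0 : derive1 (c \o chart_inv (pc x)) (pc x x) != 0.
    by apply: contraNneq Dp => t0; rewrite DE t0 mulr0.
  by rewrite -mulf_div divff // mulr1.
have hh : holomorphic_surface h.
  move=> x; have [->|xx0] := pselect (x = x0).
    exists c0; first exact: chart0.
    apply: (@holomorphic_eq _ _ _ z0 _ (holomorphic_mul (omH x0 c0 chart0) hQ)).
    apply: filterS3 n0 n1 FQ => u iu [cu cuE] FQu.
    have [->|uz] := eqVneq u z0.
      by rewrite Qz mulr0 /= (chart_mapK d0).
    by rewrite /= (hE _ c0 (iu uz) cu) -(FQu uz) /differential cuE.
  have cx := pcP x; exists (pc x); first exact: cx.
  have hf := fhol x _ xx0 cx.
  have hD := holomorphic_inv (holomorphic_derive1 hf) (D0 x _ xx0 cx).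
  apply: (@holomorphic_eq _ _ _ _ _ (holomorphic_mul (omH x _ cx) hD)).
  have nn := near_chart_neq (proj2 cx) xx0.
  apply: filterS2 nn (near_chart_at cx) => u iu [cu cuE].
  by rewrite /= (hE _ (pc x) iu cu) /differential cuE.
have h_eq0 x : h x = 0 by rewrite -h0; exact: compact_holomorphic_const.
have om0 x c : x <> x0 -> chart_at x c -> omega c x = 0.
  move=> xx0 cx; have := h_eq0 x; rewrite (hE x c xx0 cx) => /eqP.
  by rewrite mulf_eq0 invr_eq0 (negbTE (D0 x c xx0 cx)) orbF => /eqP.
have omega0 : form_eq omega (fun _ _ => 0).
  move=> x c cx; have [xx0|] := pselect (x = x0); last by move=> /om0; exact.
  rewrite {}xx0 in cx *.
  (* A nonzero coefficient at [x0] would stay nonzero nearby by continuity, whereas it vanishes off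
     [x0], and [c x0] is not isolated in [C R]. *)
  apply/eqP; apply: contraT => nz.
  have ho := omH x0 c cx.
  have oz : (omega c \o chart_inv c) (c x0) != 0.
    by rewrite /= (chart_mapK (proj2 cx)).
  have no := cts_near_neq0 (holomorphic_cts ho) oz.
  have : \forall u \near c x0, u != c x0 -> False.
    apply: filterS3 no (near_chart_punctured (proj2 cx)) (near_chart_at cx).
    move=> u ou iu [cu _] uz; move: ou; rewrite /= (om0 _ c (iu uz) cu).
    by rewrite eqxx.
  by move=> /near_punctured [].
(* The coefficients that select [omega] from the basis; linear independence then gives [1 = 0]. *)
pose a (i : 'I_g) : C R := (i == Ordinal g_gt0)%:R.
have := wfree a _ (Ordinal g_gt0); rewrite /a eqxx => ai0.
have : (1 : C R) = 0.
  apply: ai0 => x c cx; rewrite -(omega0 x c cx) /lincomb_form.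
  rewrite (bigD1 (Ordinal g_gt0)) // big1 => [|i /negbTE ni].
    by rewrite /a eqxx mul1r; exact: addr0.
  by rewrite /a ni mul0r.
by move=> /eqP; rewrite oner_eq0.
Qed.
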